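(* Let $\mathcal{M}=(\mathbb{R}^2,\nabla)$ be a Type $\mathcal{A}$ surface. There exist a linear function $\varphi$ on $\mathbb{R}^2$ and smooth functions $\phi_1,\phi_2$ on $\mathbb{R}^2$ so that $\mathcal{Q}(\mathcal{M})=e^{\varphi}\operatorname{Span}\{1,\phi_1,\phi_2\}$ and so that the map $\Phi:=(\phi_1,\phi_2)$ defines an immersion of $\mathbb{R}^2$ in $\mathbb{R}^2$. Any geodesic $\sigma$ on $\mathcal{M}$ locally has the form $\sigma(t)=\Phi^{-1}(\psi_\sigma(t)u_\sigma+v_\sigma)$ for some smooth real-valued function $\psi_\sigma$ and for suitably chosen vectors $u_\sigma$ and $v_\sigma$ in $\mathbb{R}^2$ (where $\Phi^{-1}$ denotes a local inverse of $\Phi$).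
   Context: A Type $\mathcal{A}$ surface is a pair $\mathcal{M}=(\mathbb{R}^2,\nabla)$ where $\nabla$ is a torsion free connection on the tangent bundle of $\mathbb{R}^2$ whose Christoffel symbols, defined by $\nabla_{\partial_{x^i}}\partial_{x^j}=\Gamma_{ij}{}^k\partial_{x^k}$ (summation convention), are constant in the standard coordinates $(x^1,x^2)$. A geodesic is a smooth curve $\sigma$ with $\nabla_{\dot\sigma}\dot\sigma=0$, i.e. $\ddot\sigma^k+\Gamma_{ij}{}^k\dot\sigma^i\dot\sigma^j=0$ for all $k$. Let $R(u,v)=\nabla_u\nabla_v-\nabla_v\nabla_u-\nabla_{[u,v]}$, $\rho(x,y)=\operatorname{Tr}\{z\mapsto R(z,x)y\}$, $\rho_s(x,y)=\frac12\{\rho(x,y)+\rho(y,x)\}$, and $\mathcal{H}\phi=(\partial_{x^i}\partial_{x^j}\phi-\Gamma_{ij}{}^k\partial_{x^k}\phi)\,dx^i\otimes dx^j$. Then $\mathcal{Q}(\mathcal{M})=\{\phi\in C^\infty(\mathbb{R}^2):\mathcal{H}\phi+\phi\rho_s=0\}$ is the solution space of the quasi-Einstein equation. Here $1$ denotes the constant function, spans are real, and a linear function is one of the form $\varphi(x^1,x^2)=a_1x^1+a_2x^2$ with $a_1,a_2\in\mathbb{R}$. *)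

(* Defs.v *)
From HB Require Import structures.
From mathcomp Require Import all_boot all_order all_algebra.
From mathcomp Require Import all_classical all_reals all_analysis.
Set Implicit Arguments.
Unset Strict Implicit.
Unset Printing Implicit Defensive.
Import Order.TTheory GRing.Theory Num.Theory.
Import numFieldNormedType.Exports.
Local Open Scope classical_set_scope.
Local Open Scope ring_scope.

(* Iterated directional derivatives are germ-local, so on an open set U of a
   finite-dimensional space V this says that f is C^oo on U: differentiability
   of each iterated derivative makes all of them continuous. *)
Definition smooth_on (R : realType) (V W : normedModType R) (U : set V)
    (f : V -> W) : Prop :=
  forall (s : seq V) (x : V), U x ->
    differentiable (foldr (fun (v : V) (g : V -> W) => 'D_v g) f s) x.

Definition smooth (R : realType) (V W : normedModType R) (f : V -> W) : Prop :=
  smooth_on setT f.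

Section Surface.
Variable R : realType.

Local Notation plane := 'rV[R]_2.
Local Notation vfield := (plane -> plane).

Definition basis (i : 'I_2) : plane := delta_mx 0 i.

Definition frame (i : 'I_2) : vfield := fun _ => basis i.

Definition partial (i : 'I_2) (f : plane -> R) : plane -> R := 'D_(basis i) f.

Definition lie_bracket (X Y : vfield) : vfield :=
  fun p => 'D_(X p) Y p - 'D_(Y p) X p.

(* Vector fields on the plane are raw functions; the operator is only
   constrained on smooth ones. *)
Record connection := Connection {
  nabla :> vfield -> vfield -> vfield;
  nabla_smooth : forall X Y : vfield,
    smooth X -> smooth Y -> smooth (nabla X Y);
  nabla_addl : forall X1 X2 Y : vfield,
    smooth X1 -> smooth X2 -> smooth Y ->
    forall p, nabla (fun q => X1 q + X2 q) Y p = nabla X1 Y p + nabla X2 Y p;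
  nabla_scalel : forall (f : plane -> R) (X Y : vfield),
    smooth f -> smooth X -> smooth Y ->
    forall p, nabla (fun q => f q *: X q) Y p = f p *: nabla X Y p;
  nabla_addr : forall X Y1 Y2 : vfield,
    smooth X -> smooth Y1 -> smooth Y2 ->
    forall p, nabla X (fun q => Y1 q + Y2 q) p = nabla X Y1 p + nabla X Y2 p;
  nabla_leibniz : forall (f : plane -> R) (X Y : vfield),
    smooth f -> smooth X -> smooth Y ->
    forall p, nabla X (fun q => f q *: Y q) p =
              'D_(X p) f p *: Y p + f p *: nabla X Y p }.

Definition torsion_free (D : connection) : Prop :=
  forall X Y : vfield, smooth X -> smooth Y ->
    forall p, D X Y p - D Y X p = lie_bracket X Y p.

(* christoffel D i j k is Gamma_{ij}^k. *)
Definition christoffel (D : connection) (i j k : 'I_2) (p : plane) : R :=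
  D (frame i) (frame j) p 0 k.

Definition type_A (D : connection) : Prop :=
  torsion_free D /\
  forall i j k p q, christoffel D i j k p = christoffel D i j k q.

Definition curvature (D : connection) (X Y Z : vfield) : vfield :=
  fun p => D X (D Y Z) p - D Y (D X Z) p - D (lie_bracket X Y) Z p.

(* The tangent vector z at p is extended to a constant vector field; by
   tensoriality of the curvature the choice of extension is immaterial. *)
Definition ricci (D : connection) (X Y : vfield) (p : plane) : R :=
  \tr (lin1_mx (fun z : plane => curvature D (fun _ => z) X Y p)).

Definition ricci_sym (D : connection) (X Y : vfield) (p : plane) : R :=
  2^-1 * (ricci D X Y p + ricci D Y X p).

Definition hessian (D : connection) (f : plane -> R) (i j : 'I_2)
    (p : plane) : R :=
  partial i (partial j f) p - \sum_k christoffel D i j k p * partial k f p.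

Definition quasi_einstein (D : connection) : set (plane -> R) :=
  [set f | smooth f /\
    forall i j p, hessian D f i j p
                  + f p * ricci_sym D (frame i) (frame j) p = 0].

Definition geodesic (D : connection) (I : set R) (sigma : R -> plane) : Prop :=
  [/\ open I, is_interval I, smooth_on I sigma &
    forall t, I t -> forall k : 'I_2,
      (sigma^`(2)%classic t) 0 k
      + \sum_i \sum_j christoffel D i j k (sigma t)
                      * (sigma^`()%classic t) 0 i * (sigma^`()%classic t) 0 j = 0].

Definition linear_function (f : plane -> R) : Prop :=
  exists a1 a2 : R, forall x : plane, f x = a1 * x 0 0 + a2 * x 0 1.

Definition span3 (f0 f1 f2 : plane -> R) : set (plane -> R) :=
  [set f | exists c0 c1 c2 : R,
    f = (fun p => c0 * f0 p + c1 * f1 p + c2 * f2 p)].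

Definition pair_map (f1 f2 : plane -> R) : plane -> plane :=
  fun p => \row_(k < 2) (if k == 0 then f1 p else f2 p).

Definition immersion (F : plane -> plane) : Prop :=
  smooth F /\ forall p, injective ('d F p).

Definition local_inverse (F : plane -> plane) (U V : set plane)
    (G : plane -> plane) : Prop :=
  [/\ [/\ open U, open V & smooth_on V G],
      forall x, U x -> V (F x) /\ G (F x) = x &
      forall y, V y -> U (G y) /\ F (G y) = y].

End Surface.

(* Main.v *)
From HB Require Import structures.
Require Import Defs.
From mathcomp Require Import all_boot all_order all_algebra.
From mathcomp Require Import ring lra.
From mathcomp Require Import all_classical all_reals all_analysis.
Import Order.TTheory GRing.Theory Num.Theory.
Import numFieldNormedType.Exports.
Local Open Scope classical_set_scope.
Local Open Scope ring_scope.
Set Implicit Arguments.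
Unset Strict Implicit.
Unset Printing Implicit Defensive.

(** Write (a, b), (c, d), (e, f) for the constant Christoffel symbols
    Gamma_11, Gamma_12, Gamma_22.  The function exp (s x1 + t x2) solves the
    quasi-Einstein equation exactly when (s, t) lies on three plane conics, and
    these always share a real point (quadrics_meet): after a translation one
    coordinate is a root of a real cubic, as the odd dimension 3 of the solution
    space suggests.

    Divide the solutions by that exponential.  The quotients h satisfy
    d_i d_j h = Gamma'_ij^k d_k h with
    Gamma'_ij^k = Gamma_ij^k - phi_i delta_j^k - phi_j delta_i^k, phi = (s, t).
    So the new connection is projectively equivalent to the old one, and the
    equations of the conics say that it is flat (quadric_point_flat): the two
    matrices of the linear system for dh commute.  The h are thus the affine
    functions of a flat connection.  Multiplying exponentials of the two
    matrices gives two of them, phi1 and phi2, whose differentials at the origin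
    are the coordinate ones (affine_function_exists).  A Wronskian argument shows that
    dphi1 and dphi2 are independent everywhere and that 1, phi1, phi2 span
    (wronskian_exp, affine_function_span).  This gives the description of the
    solution space and the immersion.

    Along a geodesic sigma, (h o sigma)'' = -2 phi(sigma') (h o sigma)', so
    exp (2 phi(sigma)) (h o sigma)' is constant (geodesic_velocity).  For
    Phi = (phi1, phi2), the velocity of Phi o sigma therefore keeps a constant
    direction u and Phi o sigma runs on a line (velocity_line); the parameter
    psi on that line is a fixed linear combination of the components of Phi o sigma,
    hence smooth.  What remains is to invert Phi locally by a smooth map
    (inverse_function), which is the inverse function theorem, proved by
    contraction.

    All smoothness claims go through smooth_alg_on: a family of functions whose
    partial derivatives are polynomials in the family consists of smooth
    functions. *)

(** * Differentials *)

Lemma is_diff_add (R : numFieldType) (V W : normedModType R) (f g df dg : V -> W) x :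
  is_diff x f df -> is_diff x g dg ->
  is_diff x (fun y => f y + g y) (fun v => df v + dg v).
Proof. by move=> hf hg; exact: is_diffD. Qed.

Lemma is_diff_sub (R : numFieldType) (V W : normedModType R) (f g df dg : V -> W) x :
  is_diff x f df -> is_diff x g dg ->
  is_diff x (fun y => f y - g y) (fun v => df v - dg v).
Proof. by move=> hf hg; exact: is_diffB. Qed.

Lemma is_diff_mul (R : numFieldType) (V : normedModType R) (f g df dg : V -> R) x :
  is_diff x f df -> is_diff x g dg ->
  is_diff x (fun y => f y * g y) (fun v => f x * dg v + g x * df v).
Proof. by move=> hf hg; exact: is_diffM. Qed.

Lemma is_diff_ext (R : numFieldType) (V W : normedModType R) (f df dg : V -> W) x :
  is_diff x f df -> df =1 dg -> is_diff x f dg.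
Proof. by move=> hf /funext <-. Qed.

Lemma is_diff_const (R : numFieldType) (V W : normedModType R) (a : W) (x : V) :
  is_diff x (fun=> a) (fun=> 0).
Proof. exact: is_diff_cst. Qed.

Lemma is_diff_coord (R : numFieldType) (V : normedModType R) m n
    (f df : V -> 'M[R]_(m, n)) x i j :
  is_diff x f df -> is_diff x (fun y => f y i j) (fun v => df v i j).
Proof.
move=> hf; pose c := fun N : 'M[R]_(m, n) => N i j : R.
have clin : linear_for *%R c by move=> a u v; rewrite /c !mxE.
pose cM := GRing.isLinear.Build _ _ _ _ c clin.
pose l : {linear 'M[R]_(m, n) -> R} := HB.pack c cM.
have hc : is_diff (f x) c c.
  apply: DiffDef; first exact: differentiable_coord.
  by rewrite -[c]/(l : _ -> _) diff_lin //; exact: coord_continuous.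
exact: is_diff_comp.
Qed.

Lemma is_diff_comp1 (R : numFieldType) (V : normedModType R) (f df : V -> R)
    (g : R -> R) g' x :
  is_diff x f df -> is_derive (f x) 1 g g' ->
  is_diff x (fun y => g (f y)) (fun v => g' * df v).
Proof.
move=> hf [hg hg'].
have dg : differentiable g (f x) by apply/derivable1_diffP.
have hd : is_diff (f x) g (fun v => g' * v).
  apply: DiffDef => //; rewrite deriv1E // derive1E hg'.
  by apply/funext => v; rewrite /= mulrC.
exact: is_diff_comp.
Qed.

Lemma is_diff_derive (R : numFieldType) (V W : normedModType R) (f df : V -> W) x v :
  is_diff x f df -> 'D_v f x = df v.
Proof. by move=> [h <-]; exact: deriveE. Qed.

Lemma is_diff_is_derive (R : realType) (f df : R -> R) (t : R) :
  is_diff t f df -> is_derive t 1 f (df 1).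
Proof.
move=> hf; apply: DeriveDef; first by apply: diff_derivable; have [] := hf.
by rewrite (is_diff_derive _ hf).
Qed.

Lemma is_diff_velocity (R : realType) (W : normedModType R) (f : R -> W) (x : R) :
  differentiable f x -> is_diff x f (fun r : R => r *: 'D_1 f x).
Proof.
move=> df; apply: is_diff_ext (differentiableP df) _ => r.
by rewrite deriveE // -linearZ /= [_%:A]mulr1.
Qed.

Lemma diff_rV (R : realType) n (W : normedModType R) (h : 'rV[R]_n -> W) x v :
  differentiable h x -> 'd h x v = \sum_i v 0 i *: 'D_(delta_mx 0 i) h x.
Proof.
move=> dh; rewrite {1}(row_sum_delta v) linear_sum; apply: eq_bigr => i _.
by rewrite linearZ deriveE.
Qed.

Lemma is_diff_eps (R : realType) (V W : normedModType R) (f : V -> W)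
    (df : {linear V -> W}) x :
  continuous df ->
  (forall e, 0 < e -> \forall h \near 0, `|f (h + x) - f x - df h| <= e * `|h|) ->
  is_diff x f df.
Proof.
move=> dfc fe.
have fo : f \o shift x = cst (f x) + df +o_ (0 : V) id.
  apply/eqaddoP => _/posnumP[e]; have := fe e%:num.
  move=> /(_ (gt0 e)); apply: filterS => h /=.
  by rewrite !fctE /= opprD addrA.
have fdf := diff_unique dfc fo.
by apply: DiffDef => //; apply/diff_locallyP; rewrite fdf.
Qed.

Lemma near_eq_differentiable (R : realType) (V W : normedModType R)
    (f g : V -> W) x :
  (\near x, f x = g x) -> differentiable g x -> differentiable f x.
Proof.
move=> fg dg.
have [] // : is_diff x f ('d g x).
apply: is_diff_eps; first exact: diff_continuous.
move=> e e0; have /diff_locallyP[_ /eqaddoP /(_ e e0)] := dg.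
move: fg; rewrite (near_shift 0) => fg; have fg0 := nbhs_singleton fg.
move: fg; apply: filterS2 => h /=; rewrite !fctE /= subr0 => ->.
by move: fg0; rewrite /= subr0 add0r => ->; rewrite opprD addrA.
Qed.

Lemma open_near (T : topologicalType) (U : set T) (P : T -> Prop) x :
  open U -> U x -> (forall y, U y -> P y) -> \forall y \near x, P y.
Proof.
move=> oU Ux UP; have : \forall y \near x, U y by exact: open_nbhs_nbhs.
exact: filterS.
Qed.

Lemma derive_eq_on (R : realType) (V W : normedModType R) (U : set V)
    (f g : V -> W) v x :
  open U -> U x -> (forall y, U y -> f y = g y) -> 'D_v f x = 'D_v g x.
Proof. by move=> oU Ux fg; apply: near_eq_derive; exact: open_near oU Ux fg. Qed.

Lemma derive_coord (R : realType) (V : normedModType R) m n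
    (f : V -> 'M[R]_(m, n)) x v i j :
  differentiable f x -> 'D_v (fun y => f y i j) x = 'D_v f x i j.
Proof.
move=> /differentiableP df; rewrite (is_diff_derive v df).
by rewrite (is_diff_derive v (is_diff_coord i j df)).
Qed.

Lemma differentiable_mx (R : realType) (V : normedModType R) m n
    (f : V -> 'M[R]_(m, n)) x :
  (forall i j, differentiable (fun y => f y i j) x) -> differentiable f x.
Proof.
move=> h; have -> : f = \sum_(i < m) (fun y => \sum_(j < n) f y i j *: delta_mx i j).
  by apply/funext => y; rewrite fct_sumE; exact: matrix_sum_delta.
apply: differentiable_sum => i.
have -> : (fun y => \sum_(j < n) f y i j *: delta_mx i j) =
  \sum_(j < n) (fun y => f y i j *: (delta_mx i j : 'M[R]_(m, n))).
  by apply/funext => y; rewrite fct_sumE.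
by apply: differentiable_sum => j; exact: differentiableZl.
Qed.

(** * Smooth functions *)

Inductive smooth_alg (R : realType) (V : normedModType R)
    (C : (V -> R) -> Prop) : (V -> R) -> Prop :=
| alg_gen f of C f : smooth_alg C f
| alg_const a : smooth_alg C (fun=> a)
| alg_add f g of smooth_alg C f & smooth_alg C g :
    smooth_alg C (fun x => f x + g x)
| alg_mul f g of smooth_alg C f & smooth_alg C g :
    smooth_alg C (fun x => f x * g x).

Lemma smooth_alg_sum (R : realType) (V : normedModType R) (C : (V -> R) -> Prop)
    (T : Type) (s : seq T) (P : pred T) (F : T -> V -> R) :
  (forall i, P i -> smooth_alg C (F i)) ->
  smooth_alg C (fun x => \sum_(i <- s | P i) F i x).
Proof.
move=> h; elim: s => [|i s ih].
  have -> : (fun x => \sum_(i <- [::] | P i) F i x) = (fun=> 0).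
    by apply/funext => x; rewrite big_nil.
  exact: alg_const.
case Pi : (P i); last first.
  by have -> : (fun x => \sum_(j <- i :: s | P j) F j x) =
      (fun x => \sum_(j <- s | P j) F j x)
    by apply/funext => x; rewrite big_cons Pi.
have -> : (fun x => \sum_(j <- i :: s | P j) F j x) =
    (fun x => F i x + \sum_(j <- s | P j) F j x).
  by apply/funext => x; rewrite big_cons Pi.
by apply: alg_add => //; exact: h.
Qed.

Lemma smooth_alg_prod (R : realType) (V : normedModType R) (C : (V -> R) -> Prop)
    (T : Type) (s : seq T) (F : T -> V -> R) :
  (forall i, smooth_alg C (F i)) ->
  smooth_alg C (fun x => \prod_(i <- s) F i x).
Proof.
move=> h; elim: s => [|i s ih].
  have -> : (fun x => \prod_(i <- [::]) F i x) = (fun=> 1).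
    by apply/funext => x; rewrite big_nil.
  exact: alg_const.
have -> : (fun x => \prod_(j <- i :: s) F j x) =
    (fun x => F i x * \prod_(j <- s) F j x).
  by apply/funext => x; rewrite big_cons.
exact: alg_mul.
Qed.

(** Iterated derivatives never leave the algebra generated by C, and all its
    elements are differentiable. *)
Lemma smooth_alg_on (R : realType) (V : normedModType R) (U : set V)
    (C : (V -> R) -> Prop) : open U ->
  (forall f, C f -> (forall x, U x -> differentiable f x) /\
     forall v, exists2 g, smooth_alg C g & forall x, U x -> 'D_v f x = g x) ->
  forall f, smooth_alg C f -> smooth_on U f.
Proof.
move=> oU hC.
have step f : smooth_alg C f -> (forall x, U x -> differentiable f x) /\
     forall v, exists2 g, smooth_alg C g & forall x, U x -> 'D_v f x = g x.
  elim => {f} [f /hC //|a|f g _ [df Df] _ [dg Dg]|f g Cf [df Df] Cg [dg Dg]].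
  - split=> [x _|v]; first exact: differentiable_cst.
    by exists (fun=> 0); [exact: alg_const|move=> x _; exact: derive_cst].
  - split=> [x Ux|v]; first by apply: differentiableD; [exact: df|exact: dg].
    have [f' Cf' ff'] := Df v; have [g' Cg' gg'] := Dg v.
    exists (fun x => f' x + g' x); first exact: alg_add.
    move=> x Ux; rewrite -ff'// -gg'//.
    by apply: deriveD; apply: diff_derivable; [exact: df|exact: dg].
  - split=> [x Ux|v]; first by apply: differentiableM; [exact: df|exact: dg].
    have [f' Cf' ff'] := Df v; have [g' Cg' gg'] := Dg v.
    exists (fun x => f x * g' x + g x * f' x).
      by apply: alg_add; apply: alg_mul.
    move=> x Ux; rewrite -ff'// -gg'//.
    by apply: deriveM; apply: diff_derivable; [exact: df|exact: dg].
have iter (f : V -> R) (s : seq V) : smooth_alg C f ->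
    exists2 g, smooth_alg C g &
      forall x, U x -> foldr (fun v (g : V -> R) => 'D_v g) f s x = g x.
  move=> Cf; elim: s => [|v s [g Cg fg]]; first by exists f.
  have [_ /(_ v) [g' Cg' gg']] := step _ Cg.
  by exists g' => // x Ux; rewrite -gg' //=; exact: derive_eq_on oU Ux fg.
move=> f Cf s x Ux; have [g Cg fg] := iter f s Cf.
have [dg _] := step g Cg.
apply: near_eq_differentiable (dg x Ux); exact: open_near oU Ux fg.
Qed.

Lemma smooth_on_differentiable (R : realType) (V W : normedModType R)
    (U : set V) (f : V -> W) x :
  smooth_on U f -> U x -> differentiable f x.
Proof. by move=> sf Ux; exact: (sf [::]). Qed.

Lemma smooth_on_derive (R : realType) (V W : normedModType R) (U : set V)
    (f : V -> W) v :
  smooth_on U f -> smooth_on U ('D_v f).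
Proof. by move=> sf s x Ux; have := sf (rcons s v) x Ux; rewrite foldr_rcons. Qed.

Lemma smooth_on_alg (R : realType) (V : normedModType R) (U : set V) f :
  open U -> smooth_alg (@smooth_on R V R U) f -> smooth_on U f.
Proof.
move=> oU; apply: smooth_alg_on => // g sg; split.
  by move=> x; exact: smooth_on_differentiable.
by move=> v; exists ('D_v g) => //; apply: alg_gen; exact: smooth_on_derive.
Qed.

Lemma smooth_onM (R : realType) (V : normedModType R) (U : set V) (f g : V -> R) :
  open U -> smooth_on U f -> smooth_on U g -> smooth_on U (fun x => f x * g x).
Proof.
by move=> oU sf sg; apply: smooth_on_alg => //; apply: alg_mul; apply: alg_gen.
Qed.

Lemma smooth_on_inv (R : realType) (V : normedModType R) (U : set V) (f : V -> R) :
  open U -> smooth_on U f -> (forall x, U x -> f x != 0) ->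
  smooth_on U (fun x => (f x)^-1).
Proof.
move=> oU sf f0.
pose C (g : V -> R) := smooth_on U g \/ g = fun x => (f x)^-1.
apply: (@smooth_alg_on _ _ _ C) => //; last by apply: alg_gen; right.
move=> g [sg|->]; split.
- by move=> x; exact: smooth_on_differentiable.
- move=> v; exists ('D_v g) => //; apply: alg_gen; left; exact: smooth_on_derive.
- move=> x Ux; apply: differentiableV; last exact: f0.
  exact: smooth_on_differentiable sf Ux.
- move=> v; exists (fun x => (-1 * ((f x)^-1 * (f x)^-1)) * 'D_v f x).
    apply: alg_mul; last by apply: alg_gen; left; exact: smooth_on_derive.
    apply: alg_mul; first exact: alg_const.
    by apply: alg_mul; apply: alg_gen; right.
  move=> x Ux; rewrite deriveV ?f0//; last first.
    by apply: diff_derivable; exact: smooth_on_differentiable sf Ux.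
  by rewrite mulN1r expr2 invfM.
Qed.

Lemma smooth_const (R : realType) (V W : normedModType R) (a : W) :
  smooth (fun _ : V => a).
Proof.
have H s : exists b, foldr (fun v (g : V -> W) => 'D_v g) (fun=> a) s = fun=> b.
  elim: s => [|v s [b IH]]; first by exists a.
  by exists 0; rewrite /= IH; apply/funext => x; exact: derive_cst.
by move=> s x _; have [b ->] := H s; exact: differentiable_cst.
Qed.

Lemma smooth_on_coord (R : realType) (V : normedModType R) m n (U : set V)
    (f : V -> 'M[R]_(m, n)) i j :
  open U -> smooth_on U f -> smooth_on U (fun x => f x i j).
Proof.
move=> oU sf s x Ux.
have E t y : U y -> foldr (fun v (g : V -> R) => 'D_v g) (fun z => f z i j) t y
    = foldr (fun v (g : V -> 'M[R]_(m, n)) => 'D_v g) f t y i j.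
  elim: t y => [//|v t ih] y Uy /=.
  by rewrite (derive_eq_on v oU Uy ih) derive_coord //; exact: sf.
apply: near_eq_differentiable (_ : differentiable (fun y =>
   foldr (fun v (g : V -> 'M[R]_(m, n)) => 'D_v g) f s y i j) x); last first.
  by have /differentiableP/(is_diff_coord i j)[] := sf s x Ux.
exact: open_near oU Ux (E s).
Qed.

Lemma smooth_on_mx (R : realType) (V : normedModType R) m n (U : set V)
    (f : V -> 'M[R]_(m, n)) :
  open U -> (forall i j, smooth_on U (fun x => f x i j)) -> smooth_on U f.
Proof.
move=> oU sf s.
pose F s := foldr (fun v (g : V -> 'M[R]_(m, n)) => 'D_v g) f s.
have E t : (forall y, U y -> differentiable (F t) y) /\
    forall y i j, U y -> F t y i j =
      foldr (fun v (g : V -> R) => 'D_v g) (fun z => f z i j) t y.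
  elim: t => [|v t [dt ih]]; first split=> // y Uy.
    by apply: differentiable_mx => i j; exact: (sf i j [::]).
  have ih' y i j : U y -> F (v :: t) y i j =
      foldr (fun v (g : V -> R) => 'D_v g) (fun z => f z i j) (v :: t) y.
    move=> Uy /=; rewrite -derive_coord; last exact: dt.
    by apply: derive_eq_on oU Uy _ => z; exact: ih.
  split=> // y Uy; apply: differentiable_mx => i j.
  apply: near_eq_differentiable (sf i j (v :: t) y Uy).
  exact: open_near oU Uy (fun z => ih' z i j).
by have [] := E s.
Qed.

Lemma smooth_coord (R : realType) m n i j :
  smooth (fun x : 'M[R]_(m, n) => x i j).
Proof.
pose C (f : 'M[R]_(m, n) -> R) := f = fun x => x i j.
apply: (@smooth_alg_on _ _ setT C openT) => [_ ->|]; last exact: alg_gen.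
split=> [x _|v]; first exact: differentiable_coord.
exists (fun=> v i j); first exact: alg_const.
by move=> x _; rewrite (is_diff_derive v (is_diff_coord i j (is_diff_id x))).
Qed.

Lemma smooth_on_det (R : realType) (V : normedModType R) n (U : set V)
    (A : V -> 'M[R]_n) :
  open U -> (forall i j, smooth_on U (fun x => A x i j)) ->
  smooth_on U (fun x => \det (A x)).
Proof.
move=> oU sA; apply: smooth_on_alg => //; apply: smooth_alg_sum => s _.
apply: alg_mul; first exact: alg_const.
by apply: smooth_alg_prod => i; apply: alg_gen.
Qed.

(** The entries of the inverse are cofactors divided by the determinant. *)
Lemma smooth_on_invmx (R : realType) (V : normedModType R) n (U : set V)
    (A : V -> 'M[R]_n) i j :
  open U -> (forall i j, smooth_on U (fun x => A x i j)) ->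
  (forall x, A x \in unitmx) -> smooth_on U (fun x => invmx (A x) i j).
Proof.
move=> oU sA uA.
have -> : (fun x => invmx (A x) i j) = (fun x => (\det (A x))^-1 *
    ((-1) ^+ (j + i) * \det (row' j (col' i (A x))))).
  by apply/funext => x; rewrite /invmx uA !mxE.
apply: smooth_onM => //.
  apply: smooth_on_inv => //; first exact: smooth_on_det.
  by move=> x _; have := uA x; rewrite unitmxE unitfE.
apply: smooth_on_alg => //; apply: alg_mul; first exact: alg_const.
apply: alg_gen; apply: smooth_on_det => // k l.
rewrite (_ : (fun _ => _) = (fun x => A x (lift j k) (lift i l)))//.
by apply/funext => x; rewrite !mxE.
Qed.

Lemma smooth_jacobian (R : realType) m n (F : 'rV[R]_m -> 'rV[R]_n) i j :
  smooth F -> smooth (fun x => jacobian F x i j).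
Proof.
move=> sF; have -> : (fun x => jacobian F x i j) =
    (fun x => 'D_(delta_mx 0 i) F x 0 j).
  by apply/funext => x; rewrite deriveE ?mxE//; exact: (sF [::]).
by apply: smooth_on_coord; [exact: openT|exact: smooth_on_derive].
Qed.

(** The hypothesis on the derivatives of g is self-referential on purpose: they
    may be expressed through composites with g itself.  An inverse function G of
    F is such a map, since its differential is the inverse Jacobian of F
    composed with G; the criterion then gives smoothness of G without an
    induction on the order of differentiability. *)
Lemma smooth_on_comp (R : realType) (V : normedModType R) n (U : set V)
    (g : V -> 'rV[R]_n) :
  open U -> (forall x, U x -> differentiable g x) ->
  (forall v i, exists2 k,
     smooth_alg (fun f => smooth_on U f \/
       exists2 h : 'rV[R]_n -> R, smooth h & f = h \o g) k &
     forall x, U x -> 'D_v g x 0 i = k x) ->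
  forall h : 'rV[R]_n -> R, smooth h -> smooth_on U (h \o g).
Proof.
move=> oU dg Dg h sh.
pose C (f : V -> R) := smooth_on U f \/
  exists2 h : 'rV[R]_n -> R, smooth h & f = h \o g.
apply: (@smooth_alg_on _ _ _ C) => //; last by apply: alg_gen; right; exists h.
move=> f [sf|[{}h {}sh ->]]; first split.
- by move=> x; exact: smooth_on_differentiable.
- by move=> v; exists ('D_v f) => //; apply: alg_gen; left; exact: smooth_on_derive.
split=> [x Ux|v].
  by apply: differentiable_comp; [exact: dg|exact: (sh [::])].
have /choice[k kP] : forall i, exists k, smooth_alg C k /\
    forall x, U x -> 'D_v g x 0 i = k x.
  by move=> i; have [k ? ?] := Dg v i; exists k.
exists (fun x => \sum_i k i x * 'D_(delta_mx 0 i) h (g x)).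
  apply: smooth_alg_sum => i _; apply: alg_mul; first by have [] := kP i.
  apply: alg_gen; right; exists ('D_(delta_mx 0 i) h) => //.
  exact: smooth_on_derive.
move=> x Ux; have dgx := dg _ Ux.
have dh : differentiable h (g x) by exact: (sh [::]).
rewrite deriveE; last exact: differentiable_comp.
rewrite diff_comp //= diff_rV //; apply: eq_bigr => i _.
by rewrite -deriveE //; have [_ ->] := kP i.
Qed.

Lemma smooth_on_comp_curve (R : realType) (I : set R) (sigma : R -> 'rV[R]_2)
    (h : 'rV[R]_2 -> R) :
  open I -> smooth_on I sigma -> smooth h -> smooth_on I (h \o sigma).
Proof.
move=> oI ss; apply: smooth_on_comp => // [x Ix|v i]; first exact: (ss [::]).
exists (fun x => 'D_v sigma x 0 i) => //; apply: alg_gen; left.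
by apply: smooth_on_coord => //; exact: smooth_on_derive.
Qed.

(** * The inverse function theorem *)

Lemma normr_coord_le (R : realType) m n (M : 'M[R]_(m, n)) i j :
  `|M i j| <= `|M|.
Proof.
rewrite [leRHS]/Num.Def.normr/= mx_normrE.
exact: (le_bigmax _ (fun ij => `|M ij.1 ij.2|) (i, j)).
Qed.

Lemma normr_mx_le (R : realType) m n (M : 'M[R]_(m, n)) e :
  0 <= e -> (forall i j, `|M i j| <= e) -> `|M| <= e.
Proof.
move=> e0 h; rewrite [leLHS]/Num.Def.normr/= mx_normrE.
by apply: bigmax_le => // -[i j] _; exact: h.
Qed.

Lemma normr_mulmx_le (R : realType) m n (v : 'rV[R]_m) (M : 'M[R]_(m, n)) e :
  0 <= e -> (forall i j, `|M i j| <= e) -> `|v *m M| <= m%:R * e * `|v|.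
Proof.
move=> e0 Me; apply: normr_mx_le => [|i j]; first by rewrite !mulr_ge0.
rewrite mxE; apply: (le_trans (ler_norm_sum _ _ _)).
have -> : m%:R * e * `|v| = \sum_(k < m) `|v| * e.
  by rewrite sumr_const card_ord -[RHS]mulr_natl mulrA mulrAC.
apply: ler_sum => k _; rewrite normrM ler_pM//.
exact: normr_coord_le.
Qed.

Lemma mulmxr_continuous (R : realType) m n (M : 'M[R]_(m, n)) :
  continuous (fun v : 'rV[R]_m => v *m M).
Proof.
apply: (@bounded_linear_continuous _ _ _ (mulmxr M)).
have [B B0 MB] : exists2 B, 0 <= B & forall i j, `|M i j| <= B.
  by exists `|M| => // i j; exact: normr_coord_le.
apply/bounded_funP => r; exists (m%:R * B * r) => v vr.
apply: le_trans (normr_mulmx_le v B0 MB) _.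
by rewrite ler_wpM2l// mulr_ge0.
Qed.

Lemma is_diff_mulmxr (R : realType) (V : normedModType R) m n
    (f df : V -> 'rV[R]_m) x (B : 'M[R]_(m, n)) :
  is_diff x f df -> is_diff x (fun y => f y *m B) (fun v => df v *m B).
Proof.
move=> hf.
have hB : is_diff (f x) (mulmxr B : 'rV[R]_m -> 'rV[R]_n) (mulmxr B).
  apply: DiffDef; first exact/linear_differentiable/mulmxr_continuous.
  by rewrite diff_lin //; exact: mulmxr_continuous.
exact: is_diff_comp.
Qed.

(** Apply the one-dimensional mean value theorem to each component on the
    segment from y to x, which stays in the ball. *)
Lemma jacobian_lipschitz (R : realType) m n (g : 'rV[R]_m -> 'rV[R]_n)
    (p x y : 'rV[R]_m) (r e : R) :
  0 <= e ->
  (forall z, ball p r z ->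
     differentiable g z /\ forall i j, `|jacobian g z i j| <= e) ->
  ball p r x -> ball p r y ->
  `|g x - g y| <= m%:R * e * `|x - y|.
Proof.
move=> e0 hg px py.
apply: normr_mx_le => [|i j]; first by rewrite !mulr_ge0.
pose c (t : R) := y + t *: (x - y).
have pc (t : R) : t \in `[0, 1] -> ball p r (c t).
  rewrite in_itv/= => /andP[t0 t1]; move: px py; rewrite -!ball_normE/= => px py.
  have -> : p - c t = t *: (p - x) + (1 - t) *: (p - y).
    by rewrite /c; apply/matrixP => a b; rewrite !mxE; ring.
  apply: le_lt_trans (ler_normD _ _) _; rewrite !normrZ !ger0_norm ?subr_ge0//.
  have [->|t0'] := eqVneq t 0; first by rewrite mul0r add0r subr0 mul1r.
  have: t * `|p - x| < t * r by rewrite ltr_pM2l// lt_neqAle eq_sym t0'.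
  have: (1 - t) * `|p - y| <= (1 - t) * r by rewrite ler_wpM2l ?subr_ge0// ltW.
  lra.
have dc t : is_diff t c (fun s : R => s *: (x - y)).
  apply: is_diff_ext
    (is_diff_add (is_diff_const y t) (is_diff_scalel t (x - y))) _.
  by move=> s; rewrite add0r.
pose f (t : R) : R := g (c t) i j.
pose f' (t : R) : R := ((x - y) *m jacobian g (c t)) i j.
have df (t : R) : t \in `[0, 1] -> is_derive t 1 f (f' t).
  move=> t01; have [dg _] := hg _ (pc t t01).
  have dgc := is_diff_comp (dc t) (differentiableP dg).
  have dgcij := is_diff_coord i j dgc.
  apply: DeriveDef; first by apply: diff_derivable; have [] := dgcij.
  rewrite (is_diff_derive _ dgcij) /= scale1r.
  by rewrite /f' mul_rV_lin1.
have fc : {within `[0, 1], continuous f}.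
  by apply: derivable_within_continuous => t t01; have [] := df t t01.
have dfo (t : R) : t \in `]0, 1[ -> is_derive t 1 f (f' t).
  by move=> t01; apply: df; exact: subset_itv_oo_cc.
have [t t01 E] := MVT_segment (@ler01 R) dfo fc.
have -> : (g x - g y) i j = f 1 - f 0.
  by rewrite /f /c scale1r scale0r addr0 subrKC !mxE.
rewrite E subr0 mulr1; apply: le_trans (normr_coord_le _ _ _) _.
apply: normr_mulmx_le => // k l.
by have [_ ->] := hg _ (pc t t01).
Qed.

(** At p the differential of x - F(x) J^-1 vanishes, so its entries are small
    nearby. *)
Lemma near_contraction (R : realType) n (F : 'rV[R]_n -> 'rV[R]_n) (p : 'rV[R]_n) :
  smooth F -> jacobian F p \in unitmx ->
  exists2 r : R, 0 < r & forall x y, ball p r x -> ball p r y ->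
    `|(x - F x *m invmx (jacobian F p)) - (y - F y *m invmx (jacobian F p))|
      <= 2^-1 * `|x - y|.
Proof.
move=> sF Ju; set B := invmx _; pose g x := x - F x *m B.
have dg x : is_diff x g (fun v => v - 'd F x v *m B).
  have dF := differentiableP (sF [::] x I).
  exact: is_diff_sub (is_diff_id x) (is_diff_mulmxr B dF).
have Jg x i j : jacobian g x i j = (delta_mx 0 i - 'D_(delta_mx 0 i) F x *m B) 0 j.
  have -> : jacobian g x i j = 'd g x (delta_mx 0 i) 0 j by rewrite /jacobian mxE.
  by have [_ ->] := dg x; rewrite -deriveE //; exact: (sF [::]).
have small i j : \forall x \near p, `|jacobian g x i j| <= (2 * n%:R)^-1.
  have n0 : 0 < (2 * n%:R : R)^-1.
    rewrite invr_gt0 mulr_gt0// ltr0n.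
    by case: n {F sF Ju B g dg Jg p} i j => // -[].
  have dD := differentiableP
    (smooth_on_derive (delta_mx 0 i) sF [::] I : differentiable _ p).
  have /(is_diff_coord 0 j) [/differentiable_continuous + _] :=
    is_diff_sub (is_diff_const (delta_mx 0 i) p) (is_diff_mulmxr B dD).
  have E0 : (delta_mx 0 i - 'D_(delta_mx 0 i) F p *m B) 0 j = 0.
    rewrite deriveE; last exact: (sF [::]).
    rewrite -(mul_rV_lin1 ('d F p)) -/(jacobian F p) -mulmxA mulmxV// mulmx1.
    by rewrite subrr mxE.
  move=> /cvgrPdist_le /(_ _ n0) H; near=> x.
  rewrite Jg -normrN -sub0r -E0.
  by near: x; exact: H.
have : \forall x \near p, forall i j, `|jacobian g x i j| <= (2 * n%:R)^-1.
  have nF := nbhs_filter p.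
  exact: (filter_forall nF (fun i => filter_forall nF (small i))).
move=> /nbhs_ballP[r r0 rP]; exists r => // x y px py.
have hB z : ball p r z -> differentiable g z /\
    forall i j, `|jacobian g z i j| <= (2 * n%:R)^-1.
  by move=> pz; split; [have [] := dg z|exact: rP].
apply: le_trans (jacobian_lipschitz _ hB px py) _.
  by rewrite invr_ge0 mulr_ge0.
apply: ler_wpM2r => //; case: (n) => [|k]; first by rewrite mul0r invr_ge0.
by rewrite invfM mulrCA mulfV ?mulr1// pnatr_eq0.
Unshelve. all: by end_near. Qed.

(** The chain rule forces the differential; a Lipschitz bound on G turns the
    remainder of F at G y into a remainder of G at y. *)
Lemma inverse_is_diff (R : realType) n (F G : 'rV[R]_n -> 'rV[R]_n)
    (V : set 'rV[R]_n) (k : R) (y : 'rV[R]_n) :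
  open V -> V y -> (forall z, V z -> F (G z) = z) ->
  (forall z w, V z -> V w -> `|G z - G w| <= k * `|z - w|) ->
  differentiable F (G y) -> jacobian F (G y) \in unitmx ->
  is_diff y G (fun w => w *m invmx (jacobian F (G y))).
Proof.
move=> oV Vy FG Gk dF uJ; set M := invmx _; set x := G y in dF uJ M *.
wlog k0 : k Gk / 0 < k.
  move=> H; apply: (H (`|k| + 1)) => [z w Vz Vw|]; last by rewrite ltr_wpDl.
  apply: le_trans (Gk _ _ Vz Vw) _; apply: ler_wpM2r => //.
  by rewrite (le_trans (ler_norm k))// lerDl.
have [L L0 ML] :=
  linear_lipschitz (@mulmxr_continuous R n n M : continuous (mulmxr M)).
apply: (@is_diff_eps _ _ _ G (mulmxr M)); first exact: mulmxr_continuous.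
move=> e e0; have e'0 : 0 < e / (L * k) by rewrite divr_gt0// mulr_gt0.
have /diff_locallyP[_ /eqaddoP /(_ _ e'0)] := dF.
move=> /nbhs_ballP[d /= d0 dP].
have nV : \forall w \near (0 : 'rV[R]_n), V (w + y).
  have : \forall w \near y, V w by exact: open_nbhs_nbhs.
  by rewrite (near_shift 0) subr0.
have dk : \forall w \near (0 : 'rV[R]_n), `|w| < d / k.
  by apply: nbhs0_lt; rewrite divr_gt0.
near=> w.
have Vw : V (w + y) by near: w.
pose h := G (w + y) - x.
have hk : `|h| <= k * `|w| by have := Gk _ _ Vw Vy; rewrite addrK.
have hd : ball 0 d h.
  rewrite -ball_normE/= sub0r normrN; apply: le_lt_trans hk _.
  by rewrite mulrC -ltr_pdivlMr//; near: w.
have := dP h hd; rewrite !fctE /= /h subrK FG// FG// -/h => Fh.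
have -> : G (w + y) - G y - w *m M = - ((w + y - (y + 'd F x h)) *m M).
  rewrite -/x -/h opprD addrA addrK mulmxBl opprB; congr (_ - _).
  by rewrite -(mul_rV_lin1 ('d F x)) -mulmxA mulmxV// mulmx1.
rewrite normrN; apply: le_trans (ML _) _.
apply: le_trans (_ : L * (e / (L * k) * (k * `|w|)) <= _).
  rewrite ler_pM2l//; apply: le_trans Fh _.
  by rewrite ler_pM2l.
by rewrite le_eqVlt; apply/orP; left; apply/eqP; field; rewrite !gt_eqF.
Unshelve. all: by end_near. Qed.

Lemma inverse_smooth (R : realType) n (F G : 'rV[R]_n -> 'rV[R]_n)
    (V : set 'rV[R]_n) :
  open V -> smooth F -> (forall x, jacobian F x \in unitmx) ->
  (forall y, V y -> is_diff y G (fun w => w *m invmx (jacobian F (G y)))) ->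
  smooth_on V G.
Proof.
move=> oV sF uJ dG.
apply: smooth_on_mx => // i j.
apply: (@smooth_on_comp _ _ _ V G oV _ _ (fun x => x i j)).
- by move=> y /dG[].
- move=> w l; exists (fun y => \sum_k w 0 k * invmx (jacobian F (G y)) k l).
    apply: smooth_alg_sum => k _; apply: alg_mul; first exact: alg_const.
    apply: alg_gen; right; exists (fun x => invmx (jacobian F x) k l) => //.
    by apply: smooth_on_invmx => // [|a b]; [exact: openT|exact: smooth_jacobian].
  by move=> y Vy; rewrite (is_diff_derive w (dG y Vy)) mxE.
- exact: smooth_coord.
Qed.

(** A point x with F x = y is a fixed point of x - (F x - y) J^-1, which
    contracts a closed ball around p into itself when y is close to F p. *)
Theorem inverse_function (R : realType) n (F : 'rV[R]_n -> 'rV[R]_n)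
    (p : 'rV[R]_n) :
  smooth F -> (forall x, jacobian F x \in unitmx) ->
  exists (U V : set 'rV[R]_n) (G : 'rV[R]_n -> 'rV[R]_n),
    [/\ [/\ open U, open V & smooth_on V G],
      forall x, U x -> V (F x) /\ G (F x) = x,
      forall y, V y -> U (G y) /\ F (G y) = y & U p].
Proof.
move=> sF uJ.
have [r r0 rP] := near_contraction sF (uJ p).
set B := invmx _ in rP.
have r20 : 0 < r / 2 by rewrite divr_gt0.
(* The radius r / 4 keeps fixed points strictly inside the closed ball of radius
   r / 2 on which the contraction lives. *)
pose V : set 'rV[R]_n := [set y | ball 0 (r / 2 / 2) ((y - F p) *m B)].
pose U : set 'rV[R]_n := ball p (r / 2) `&` F @^-1` V.
have sub x : ball p (r / 2) x -> ball p r x by apply: le_ball; lra.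
have oV : open V.
  apply: (@open_comp 'rV[R]_n 'rV[R]_n (fun y => (y - F p) *m B));
    last exact: ball_open.
  move=> y _; apply: differentiable_continuous.
  by have [] := is_diff_mulmxr B
    (is_diff_sub (is_diff_id y) (is_diff_const (F p) y)).
have oU : open U.
  apply: openI; first exact: ball_open.
  by apply: open_comp => // x _; apply: differentiable_continuous; exact: (sF [::]).
have Fp : V (F p).
  by rewrite /V/= subrr mul0mx; apply: ballxx; rewrite divr_gt0.
(* This gives both the injectivity of F and a Lipschitz bound for G. *)
have expand x x' : ball p r x -> ball p r x' ->
    `|x - x'| <= 2 * `|(F x - F x') *m B|.
  move=> px px'; have := rP x x' px px'.
  have -> : x - F x *m B - (x' - F x' *m B) = (x - x') - (F x - F x') *m B.
    by rewrite mulmxBl; apply/matrixP => i j; rewrite !mxE; ring.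
  have := lerB_dist (x - x') ((F x - F x') *m B).
  lra.
have solve y : V y -> exists x, ball p (r / 2) x /\ F x = y.
  move=> Vy; pose K := closed_ball p (r / 2).
  pose T x := x - F x *m B + y *m B.
  have KE x : K x <-> `|p - x| <= r / 2 by rewrite /K closed_ballE.
  have Kr x : K x -> ball p r x.
    by move=> /KE px; rewrite -ball_normE/=; lra.
  have pr : ball p r p by exact: ballxx.
  have TB x : K x -> `|p - T x| < r / 2.
    move=> Kx; have := rP p x pr (Kr x Kx); move/KE: Kx => Kx.
    move: Vy; rewrite /V -ball_normE/= sub0r normrN => Vy.
    have -> : p - T x = (p - F p *m B - (x - F x *m B)) - (y - F p) *m B.
      by rewrite /T mulmxBl; apply/matrixP => i j; rewrite !mxE; ring.
    have := ler_normB (p - F p *m B - (x - F x *m B)) ((y - F p) *m B).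
    lra.
  have TK : set_fun K K T by move=> x /TB /ltW /KE.
  pose X : completeNormedModType R := HB.pack 'rV[R]_n
    (Uniform_isComplete.Build 'rV[R]_n (@mx_complete R 1 n)).
  pose TF : {fun K >-> K} := HB.pack T (isFun.Build _ _ K K T TK).
  have Tc : is_contraction TF.
    exists 2^-1%:nng; split => /=; first by lra.
    move=> -[x x'] [/= Kx Kx'].
    have := rP x x' (Kr _ Kx) (Kr _ Kx').
    have -> // : x - F x *m B - (x' - F x' *m B) = T x - T x'.
    by rewrite /T; apply/matrixP => i j; rewrite !mxE; ring.
  have [||x Kx xT] := @banach_fixed_point R X K TF Tc.
  - exact: closed_ball_closed.
  - by exists p; apply/KE; rewrite subrr normr0 ltW.
  exists x; split; first by rewrite -ball_normE/= {1}xT; exact: TB.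
  have : (F x - y) *m B = 0.
    rewrite mulmxBl; apply/eqP; rewrite subr_eq0 eq_sym -subr_eq0; apply/eqP.
    have /eqP := xT; rewrite /= /T -addrA -[X in X == _]addr0 (inj_eq (addrI _)).
    by rewrite addrC => /eqP <-.
  move=> /(congr1 (mulmx^~ (jacobian F p))).
  by rewrite mul0mx -mulmxA mulVmx// mulmx1 => /eqP; rewrite subr_eq0 => /eqP.
pose G y := get [set x | ball p (r / 2) x /\ F x = y].
have GP y : V y -> ball p (r / 2) (G y) /\ F (G y) = y.
  by move=> /solve xy; exact: (@getPex _ [set x | ball p (r / 2) x /\ F x = y] xy).
have GF x : U x -> G (F x) = x.
  move=> [px Vx]; have [pG FG] := GP _ Vx.
  have := expand _ _ (sub _ pG) (sub _ px).
  by rewrite FG subrr mul0mx normr0 mulr0 normr_le0 subr_eq0 => /eqP.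
have [L L0 BL] :=
  linear_lipschitz (@mulmxr_continuous R n n B : continuous (mulmxr B)).
exists U, V, G; split=> //.
- split=> //; apply: (inverse_smooth oV sF uJ) => y Vy.
  apply: (@inverse_is_diff _ _ _ _ V (2 * L)) => //.
  + by move=> z /GP[].
  + move=> z w Vz Vw; have [pz Fz] := GP _ Vz; have [pw Fw] := GP _ Vw.
    apply: le_trans (expand _ _ (sub _ pz) (sub _ pw)) _.
    by rewrite Fz Fw -mulrA ler_pM2l//; exact: BL.
  + exact: (sF [::]).
- by move=> x Ux; split; [have [] := Ux|exact: GF].
- move=> y Vy; have [pG FG] := GP _ Vy; split; last exact: FG.
  by split; [exact: pG|rewrite /preimage/= FG].
- by split=> //; exact: ballxx.
Qed.

(** * Exponentials of two by two matrices *)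

Lemma is_derive1D (R : realType) (f g : R -> R) (t a b : R) :
  is_derive t 1 f a -> is_derive t 1 g b ->
  is_derive t 1 (fun s => f s + g s) (a + b).
Proof. by move=> hf hg; exact: is_deriveD. Qed.

Lemma is_derive1Ml (R : realType) (f : R -> R) (t a k : R) :
  is_derive t 1 f a -> is_derive t 1 (fun s => k * f s) (k * a).
Proof. by move=> hf; exact: is_deriveZ. Qed.

Lemma is_derive1M (R : realType) (f g : R -> R) (t a b : R) :
  is_derive t 1 f a -> is_derive t 1 g b ->
  is_derive t 1 (fun s => f s * g s) (f t * b + g t * a).
Proof. by move=> hf hg; exact: is_deriveM. Qed.

Lemma is_derive1_scaled (R : realType) (f : R -> R) (t a k : R) :
  is_derive (k * t) 1 f a -> is_derive t 1 (fun s => f (k * s)) (k * a).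
Proof.
move=> hf; apply: is_derive_eq
  (is_derive1_comp hf (is_derive1Ml k (is_derive_id t 1))) _.
by rewrite mulr1 mulrC.
Qed.

(** These are cosh (t sqrt delta) and sinh (t sqrt delta) / sqrt delta, written
    with real functions according to the sign of delta. *)
Lemma hyperbolic_pair (R : realType) (delta : R) :
  exists c s : R -> R, [/\ c 0 = 1, s 0 = 0,
    forall t : R, is_derive t 1 c (delta * s t) &
    forall t : R, is_derive t 1 s (c t)].
Proof.
have [d0|d0|->] := ltgtP delta 0.
- pose w := Num.sqrt (- delta).
  have w0 : w != 0 by rewrite gt_eqF// sqrtr_gt0 oppr_gt0.
  have ww : delta = - (w * w) by rewrite -expr2 sqr_sqrtr ?opprK// oppr_ge0 ltW.
  exists (fun t => cos (w * t)), (fun t => w^-1 * sin (w * t)); split.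
  + by rewrite mulr0 cos0.
  + by rewrite mulr0 sin0 mulr0.
  + move=> t; apply: is_derive_eq (is_derive1_scaled (is_derive_cos (w * t))) _.
    by rewrite ww; field.
  + move=> t; apply: is_derive_eq
      (is_derive1Ml _ (is_derive1_scaled (is_derive_sin (w * t)))) _.
    by field.
- pose w := Num.sqrt delta.
  have w0 : w != 0 by rewrite gt_eqF// sqrtr_gt0.
  have ww : delta = w * w by rewrite -expr2 sqr_sqrtr// ltW.
  have E (k t : R) : is_derive t 1 (fun s : R => expR (k * s)) (k * expR (k * t)).
    by apply: is_derive1_scaled; exact: is_derive_expR.
  exists (fun t => 2^-1 * (expR (w * t) + expR (- w * t))),
         (fun t => (2 * w)^-1 * (expR (w * t) + (-1) * expR (- w * t))); split.
  + by rewrite !mulr0 expR0; field.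
  + by rewrite !mulr0 expR0; ring.
  + move=> t; apply: is_derive_eq
      (is_derive1Ml _ (is_derive1D (E w t) (E (- w) t))) _.
    by rewrite ww; field.
  + move=> t; apply: is_derive_eq (is_derive1Ml _ (is_derive1D (E w t)
      (is_derive1Ml _ (E (- w) t)))) _.
    by field.
- exists (fun=> 1), id; split=> // t; rewrite ?mul0r; [exact: is_derive_cst|].
  exact: is_derive_id.
Qed.

(** For a matrix B with trace tau and determinant D, the Cayley-Hamilton theorem
    gives exp (t B) = (1 - D w) + z B, and the primitive of exp (t B) vanishing
    at 0 is (z - tau w) + w B. *)
Lemma second_order_ode (R : realType) (tau D : R) :
  exists w z : R -> R, [/\ w 0 = 0, z 0 = 0,
    forall t : R, is_derive t 1 w (z t) &
    forall t : R, is_derive t 1 z (1 + tau * z t - D * w t)].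
Proof.
have E (k t : R) : is_derive t 1 (fun s : R => expR (k * s)) (k * expR (k * t)).
  by apply: is_derive1_scaled; exact: is_derive_expR.
have X (t : R) : is_derive t 1 (fun s : R => s) 1 by exact: is_derive_id.
have K (k t : R) : is_derive t 1 (fun s : R => k) 0 by exact: is_derive_cst.
have [->|D0] := eqVneq D 0.
  have [->|t0] := eqVneq tau 0.
    exists (fun t => 2^-1 * (t * t)), id; split=> //=; rewrite ?mul0r ?mulr0//.
      move=> t; apply: is_derive_eq (is_derive1Ml _ (is_derive1M (X t) (X t))) _.
      by field.
    by move=> t; apply: is_derive_eq (X t) _; ring.
  pose z (t : R) : R := tau^-1 * (expR (tau * t) + -1).
  have dz (t : R) : is_derive t 1 z (1 + tau * z t).
    apply: is_derive_eq (is_derive1Ml _ (is_derive1D (E tau t) (K (-1) t))) _.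
    by rewrite /z; field.
  exists (fun t => tau^-1 * (z t + -1 * t)), z; rewrite /z; split.
  - by rewrite !mulr0 expR0; ring.
  - by rewrite mulr0 expR0; ring.
  - move=> t; apply: is_derive_eq
      (is_derive1Ml _ (is_derive1D (dz t) (is_derive1Ml (-1) (X t)))) _.
    by rewrite /z; field.
  - by move=> t; apply: is_derive_eq (dz t) _; rewrite /z; ring.
(* B - m has trace 0, so its square is the scalar m ^ 2 - D. *)
pose m := tau / 2; have [c [s [c0 s0 dc ds]]] := hyperbolic_pair (m * m - D).
have tm : tau = 2 * m by rewrite /m; field.
pose z (t : R) : R := expR (m * t) * s t.
exists (fun t => D^-1 * (1 + -1 * (expR (m * t) * (c t + - m * s t)))), z; split.
- by rewrite mulr0 expR0 c0 s0; ring.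
- by rewrite /z s0 mulr0.
- move=> t; apply: is_derive_eq (is_derive1Ml _ (is_derive1D (K 1 t) (is_derive1Ml _
    (is_derive1M (E m t) (is_derive1D (dc t) (is_derive1Ml _ (ds t))))))) _.
  by rewrite /z; field.
- move=> t; apply: is_derive_eq (is_derive1M (E m t) (ds t)) _.
  by rewrite /z tm; field.
Qed.

(** * Functions with prescribed gradient on the plane *)

Lemma sum_ord2 (V : nmodType) (F : 'I_2 -> V) : \sum_(i < 2) F i = F 0 + F 1.
Proof. by rewrite big_ord_recl big_ord1; congr (_ + F _); exact: val_inj. Qed.

Lemma forall_ord2 (P : 'I_2 -> Prop) : P 0 -> P 1 -> forall i, P i.
Proof.
move=> P0 P1 [[|[|//]] h].
  by rewrite (_ : Ordinal h = 0)//; exact: val_inj.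
by rewrite (_ : Ordinal h = 1)//; exact: val_inj.
Qed.

Definition gradient (R : realType) (h p q : 'rV[R]_2 -> R) :=
  forall x, is_diff x h (fun v => v 0 0 * p x + v 0 1 * q x).

Lemma gradient_eq (R : realType) (h p q p' q' : 'rV[R]_2 -> R) :
  gradient h p q -> p =1 p' -> q =1 q' -> gradient h p' q'.
Proof. by move=> + /funext <- /funext <-. Qed.

Lemma gradient_const (R : realType) (k : R) : gradient (fun=> k) (fun=> 0) (fun=> 0).
Proof.
by move=> x; apply: is_diff_ext (is_diff_const k x) _ => v; rewrite !mulr0 addr0.
Qed.

Lemma gradientD (R : realType) (h p q h' p' q' : 'rV[R]_2 -> R) :
  gradient h p q -> gradient h' p' q' ->
  gradient (fun x => h x + h' x) (fun x => p x + p' x) (fun x => q x + q' x).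
Proof.
by move=> hg hg' x; apply: is_diff_ext (is_diff_add (hg x) (hg' x)) _ => v; ring.
Qed.

Lemma gradientM (R : realType) (h p q h' p' q' : 'rV[R]_2 -> R) :
  gradient h p q -> gradient h' p' q' ->
  gradient (fun x => h x * h' x) (fun x => h x * p' x + p x * h' x)
    (fun x => h x * q' x + q x * h' x).
Proof.
by move=> hg hg' x; apply: is_diff_ext (is_diff_mul (hg x) (hg' x)) _ => v; ring.
Qed.

Lemma gradientZ (R : realType) (k : R) (h p q : 'rV[R]_2 -> R) :
  gradient h p q ->
  gradient (fun x => k * h x) (fun x => k * p x) (fun x => k * q x).
Proof.
move=> hg; apply: gradient_eq (gradientM (gradient_const k) hg) _ _ => x; ring.
Qed.

Lemma gradient_comp (R : realType) (g g' : R -> R) (h p q : 'rV[R]_2 -> R) :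
  (forall t : R, is_derive t 1 g (g' t)) -> gradient h p q ->
  gradient (fun x => g (h x)) (fun x => g' (h x) * p x) (fun x => g' (h x) * q x).
Proof.
by move=> dg hg x; apply: is_diff_ext (is_diff_comp1 (hg x) (dg (h x))) _ => v; ring.
Qed.

Lemma gradient_x (R : realType) :
  gradient (fun x : 'rV[R]_2 => x 0 0) (fun=> 1) (fun=> 0).
Proof.
by move=> x; apply: is_diff_ext (is_diff_coord 0 0 (is_diff_id x)) _ => v; ring.
Qed.

Lemma gradient_y (R : realType) :
  gradient (fun x : 'rV[R]_2 => x 0 1) (fun=> 0) (fun=> 1).
Proof.
by move=> x; apply: is_diff_ext (is_diff_coord 0 1 (is_diff_id x)) _ => v; ring.
Qed.

Lemma gradient_exp (R : realType) (s t : R) :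
  let E (x : 'rV[R]_2) := expR (s * x 0 0 + t * x 0 1) in
  gradient E (fun x => s * E x) (fun x => t * E x).
Proof.
move=> E; apply: gradient_eq (gradient_comp (@is_derive_expR R)
  (gradientD (gradientZ s (@gradient_x R)) (gradientZ t (@gradient_y R)))) _ _ => x;
by rewrite /E; ring.
Qed.

Lemma gradient_partial (R : realType) (h p q : 'rV[R]_2 -> R) :
  gradient h p q -> partial 0 h = p /\ partial 1 h = q.
Proof.
move=> hg; split; apply/funext => x; rewrite /partial (is_diff_derive _ (hg x));
by rewrite !mxE /= ?mulr1n ?mulr0n; ring.
Qed.

Lemma smooth_gradient (R : realType) (h : 'rV[R]_2 -> R) :
  smooth h -> gradient h (partial 0 h) (partial 1 h).
Proof.
move=> sh x; have dh := sh [::] x I.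
by apply: is_diff_ext (differentiableP dh) _ => v; rewrite diff_rV// sum_ord2.
Qed.

(** By restriction to the lines through the origin. *)
Lemma gradient0_constant (R : realType) (g : 'rV[R]_2 -> R) x :
  gradient g (fun=> 0) (fun=> 0) -> g x = g 0.
Proof.
move=> hg; rewrite -[x]scale1r -[0](scale0r x).
apply: (@is_derive_0_is_cst _ (fun t : R => g (t *: x))) => t.
have := is_diff_is_derive (is_diff_comp (is_diff_scalel t x) (hg (t *: x))).
by move=> H; apply: (is_derive_eq H); rewrite /= !mulr0 addr0.
Qed.

(** The product of g with the inverse exponential has zero gradient. *)
Lemma log_gradient_exp (R : realType) (g : 'rV[R]_2 -> R) (s t : R) x :
  gradient g (fun x => s * g x) (fun x => t * g x) ->
  g x = g 0 * expR (s * x 0 0 + t * x 0 1).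
Proof.
move=> hg; have hE := gradient_exp (- s) (- t).
have H : gradient (fun x : 'rV[R]_2 => g x * expR (- s * x 0 0 + - t * x 0 1))
    (fun=> 0) (fun=> 0).
  by apply: gradient_eq (gradientM hg hE) _ _ => z; ring.
have := gradient0_constant x H; rewrite !mxE !mulr0 addr0 expR0 mulr1 => <-.
by rewrite -mulrA -expRD !mulNr -opprD addrC subrr expR0 mulr1.
Qed.

Lemma smooth_of_gradients (R : realType) (C : ('rV[R]_2 -> R) -> Prop) :
  (forall f, C f -> exists p q,
     [/\ gradient f p q, smooth_alg C p & smooth_alg C q]) ->
  forall f, C f -> smooth f.
Proof.
move=> hC f Cf.
apply: (@smooth_alg_on _ _ setT C openT) => [g Cg|]; last exact: alg_gen.
have [p [q [gg Cp Cq]]] := hC _ Cg.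
split=> [x _|v]; first by have [] := gg x.
exists (fun x => v 0 0 * p x + v 0 1 * q x).
  by apply: alg_add; apply: alg_mul => //; exact: alg_const.
by move=> x _; rewrite (is_diff_derive v (gg x)).
Qed.

Lemma exp_smooth (R : realType) (s t : R) :
  smooth (fun x : 'rV[R]_2 => expR (s * x 0 0 + t * x 0 1)).
Proof.
set E := fun _ => _.
apply: (@smooth_of_gradients R (fun f => f = E)) => // _ ->.
exists (fun x => s * E x), (fun x => t * E x); split; first exact: gradient_exp.
  by apply: alg_mul; [exact: alg_const|exact: alg_gen].
by apply: alg_mul; [exact: alg_const|exact: alg_gen].
Qed.

(** * Affine functions of a flat connection *)

(** The system d_i d_j h = Gamma_ij^k d_k h, with dh = (p, q) and constant
    symbols Gamma_11 = (a, b), Gamma_12 = (c, d), Gamma_22 = (e, f). *)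
Definition affine_function (R : realType) (a b c d e f : R)
    (h p q : 'rV[R]_2 -> R) :=
  [/\ gradient h p q,
    gradient p (fun x => a * p x + b * q x) (fun x => c * p x + d * q x) &
    gradient q (fun x => c * p x + d * q x) (fun x => e * p x + f * q x)].

(** Reduces an equation that holds modulo two relations to a ring identity, the
    cofactors k and l being supplied by hand. *)
Lemma eq_of_null_terms (R : realType) (x y u v k l : R) :
  u = 0 -> v = 0 -> x = y + k * u + l * v -> x = y.
Proof. by move=> -> ->; rewrite !mulr0 !addr0. Qed.

(** The three equations say that B1 = [[a, b], [c, d]] and
    B2 = [[c, d], [e, f]] commute.  The gradient is then exp (x1 B1) exp (x2 B2)
    applied to (p0, q0).
    A primitive is the first row of the integral of exp (x1 B1) applied to
    exp (x2 B2) (p0, q0), plus the second row of the integral of exp (x2 B2)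
    applied to (p0, q0); its x2-derivative is right because the first row of B2
    is the second row of B1. *)
Lemma affine_function_exists (R : realType) (a b c d e f p0 q0 : R) :
  b * e = c * d -> a * d + b * f = b * c + d * d ->
  c * c + d * e = a * e + c * f ->
  exists h p q, [/\ affine_function a b c d e f h p q, p 0 = p0 & q 0 = q0].
Proof.
move=> F1 F2 F3.
have [w1 [z1 [w10 z10 dw1 dz1]]] := second_order_ode (a + d) (a * d - b * c).
have [w2 [z2 [w20 z20 dw2 dz2]]] := second_order_ode (c + f) (c * f - d * e).
have gw1 := gradient_comp dw1 (@gradient_x R).
have gz1 := gradient_comp dz1 (@gradient_x R).
have gw2 := gradient_comp dw2 (@gradient_y R).
have gz2 := gradient_comp dz2 (@gradient_y R).
pose one := gradient_const (1 : R).
pose W1 (x : 'rV[R]_2) := w1 (x 0 0); pose Z1 (x : 'rV[R]_2) := z1 (x 0 0).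
pose W2 (x : 'rV[R]_2) := w2 (x 0 1); pose Z2 (x : 'rV[R]_2) := z2 (x 0 1).
(* exp (x1 B1) = A1 + Z1 B1 has the primitive C1 + W1 B1, and similarly in x2;
   (P2, R2) is exp (x2 B2) applied to (p0, q0). *)
pose A1 x := 1 + (b * c - a * d) * W1 x.
pose C1 x := Z1 x + - (a + d) * W1 x.
pose A2 x := 1 + (d * e - c * f) * W2 x.
pose C2 x := Z2 x + - (c + f) * W2 x.
pose P2 x := p0 * A2 x + (c * p0 + d * q0) * Z2 x.
pose R2 x := q0 * A2 x + (e * p0 + f * q0) * Z2 x.
have gA1 : gradient A1 (fun x => (b * c - a * d) * Z1 x) (fun=> 0).
  by apply: gradient_eq (gradientD one (gradientZ _ gw1)) _ _ => x; rewrite /Z1; ring.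
have gA2 : gradient A2 (fun=> 0) (fun x => (d * e - c * f) * Z2 x).
  by apply: gradient_eq (gradientD one (gradientZ _ gw2)) _ _ => x; rewrite /Z2; ring.
have gC1 : gradient C1 A1 (fun=> 0).
  by apply: gradient_eq (gradientD gz1 (gradientZ _ gw1)) _ _ => x;
     rewrite /A1 /W1; ring.
have gC2 : gradient C2 (fun=> 0) A2.
  by apply: gradient_eq (gradientD gz2 (gradientZ _ gw2)) _ _ => x;
     rewrite /A2 /W2; ring.
have gP2 : gradient P2 (fun=> 0) (fun x => c * P2 x + d * R2 x).
  apply: gradient_eq (gradientD (gradientZ _ gA2) (gradientZ _ gz2)) _ _ => x;
  by rewrite /P2 /R2 /A2 /Z2 /W2; ring.
have gR2 : gradient R2 (fun=> 0) (fun x => e * P2 x + f * R2 x).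
  apply: gradient_eq (gradientD (gradientZ _ gA2) (gradientZ _ gz2)) _ _ => x;
  by rewrite /P2 /R2 /A2 /Z2 /W2; ring.
have gL k l := gradientD (gradientZ k gP2) (gradientZ l gR2).
exists (fun x => C1 x * P2 x + W1 x * (a * P2 x + b * R2 x)
                 + (q0 * C2 x + (e * p0 + f * q0) * W2 x)),
  (fun x => A1 x * P2 x + Z1 x * (a * P2 x + b * R2 x)),
  (fun x => A1 x * R2 x + Z1 x * (c * P2 x + d * R2 x)).
have N1 : b * e - c * d = 0 by rewrite F1 subrr.
have N2 : a * d + b * f - b * c - d * d = 0 by rewrite F2; ring.
have N3 : c * c + d * e - a * e - c * f = 0 by rewrite F3; ring.
split; first split.
- apply: gradient_eq (gradientD (gradientD (gradientM gC1 gP2) (gradientM gw1 (gL a b)))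
    (gradientD (gradientZ q0 gC2) (gradientZ _ gw2))) _ _ => x.
    by rewrite /W1 /Z1; ring.
  apply: (eq_of_null_terms (k := W1 x * P2 x) (l := W1 x * R2 x) N1 N2).
  by rewrite /C1 /A1 /R2 /Z2 /W1 /Z1; ring.
- apply: gradient_eq (gradientD (gradientM gA1 gP2) (gradientM gz1 (gL a b))) _ _ => x.
    by rewrite /A1 /W1 /Z1; ring.
  apply: (eq_of_null_terms (k := Z1 x * P2 x) (l := Z1 x * R2 x) N1 N2).
  by rewrite /Z1; ring.
- apply: gradient_eq (gradientD (gradientM gA1 gR2) (gradientM gz1 (gL c d))) _ _ => x.
    by rewrite /A1 /W1 /Z1; ring.
  apply: (eq_of_null_terms (k := Z1 x * P2 x) (l := - (Z1 x * R2 x)) N3 N1).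
  by rewrite /Z1; ring.
- by rewrite /A1 /P2 /R2 /A2 /W1 /Z1 /W2 /Z2 !mxE w10 z10 w20 z20; ring.
- by rewrite /A1 /P2 /R2 /A2 /W1 /Z1 /W2 /Z2 !mxE w10 z10 w20 z20; ring.
Qed.

(** The Wronskian form on gradients satisfies a first order equation driven by
    the traces of the two matrices of the system. *)
Lemma wronskian_exp (R : realType) (a b c d e f : R)
    (h p q h' p' q' : 'rV[R]_2 -> R) x :
  affine_function a b c d e f h p q -> affine_function a b c d e f h' p' q' ->
  p x * q' x - q x * p' x =
  (p 0 * q' 0 - q 0 * p' 0) * expR ((a + d) * x 0 0 + (c + f) * x 0 1).
Proof.
move=> [_ gp gq] [_ gp' gq'].
apply: (@log_gradient_exp R (fun x => p x * q' x - q x * p' x)).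
move=> z.
apply: is_diff_ext (is_diff_sub (gradientM gp gq' z) (gradientM gq gp' z)) _ => v.
by ring.
Qed.

Lemma affine_function_constant (R : realType) (a b c d e f : R) (k : R) :
  affine_function a b c d e f (fun=> k) (fun=> 0) (fun=> 0).
Proof.
by split; first exact: gradient_const;
  apply: gradient_eq (gradient_const 0) _ _ => x; ring.
Qed.

Lemma affine_function_comb (R : realType) (a b c d e f k : R)
    (h p q h' p' q' : 'rV[R]_2 -> R) :
  affine_function a b c d e f h p q -> affine_function a b c d e f h' p' q' ->
  affine_function a b c d e f (fun x => h x + k * h' x) (fun x => p x + k * p' x)
    (fun x => q x + k * q' x).
Proof.
move=> [gh gp gq] [gh' gp' gq']; split.
- exact: gradientD gh (gradientZ k gh').
- by apply: gradient_eq (gradientD gp (gradientZ k gp')) _ _ => x; ring.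
- by apply: gradient_eq (gradientD gq (gradientZ k gq')) _ _ => x; ring.
Qed.

(** Subtract from h the combination of h1 and h2 with the same differential at
    the origin.  The Wronskians of the difference with h1 and h2 vanish at the
    origin, hence everywhere, and dh1, dh2 are independent everywhere; so the
    difference has zero gradient. *)
Lemma affine_function_span (R : realType) (a b c d e f : R)
    (h p q h1 p1 q1 h2 p2 q2 : 'rV[R]_2 -> R) :
  affine_function a b c d e f h p q ->
  affine_function a b c d e f h1 p1 q1 -> p1 0 = 1 -> q1 0 = 0 ->
  affine_function a b c d e f h2 p2 q2 -> p2 0 = 0 -> q2 0 = 1 ->
  exists k k1 k2, forall x, h x = k + k1 * h1 x + k2 * h2 x.
Proof.
move=> A A1 p10 q10 A2 p20 q20.
have A' := affine_function_comb (- q 0) (affine_function_comb (- p 0) A A1) A2.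
pose P x := p x + - p 0 * p1 x + - q 0 * p2 x.
pose Q x := q x + - p 0 * q1 x + - q 0 * q2 x.
have P0 : P 0 = 0 by rewrite /P p10 p20; ring.
have Q0 : Q 0 = 0 by rewrite /Q q10 q20; ring.
have PQ x : P x = 0 /\ Q x = 0.
  have W1 := wronskian_exp x A' A1; have W2 := wronskian_exp x A' A2.
  rewrite -/(P x) -/(Q x) -/(P 0) -/(Q 0) P0 Q0 !mul0r subrr mul0r in W1 W2.
  have W := wronskian_exp x A1 A2; rewrite p10 q10 p20 q20 in W.
  have n0 : p1 x * q2 x - q1 x * p2 x != 0.
    by rewrite W mulr1 mul0r subr0 mul1r gt_eqF// expR_gt0.
  split; apply: (mulIf n0); rewrite mul0r.
    have -> : P x * (p1 x * q2 x - q1 x * p2 x) =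
      p1 x * (P x * q2 x - Q x * p2 x) - p2 x * (P x * q1 x - Q x * p1 x) by ring.
    by rewrite W1 W2; ring.
  have -> : Q x * (p1 x * q2 x - q1 x * p2 x) =
      q1 x * (P x * q2 x - Q x * p2 x) - q2 x * (P x * q1 x - Q x * p1 x) by ring.
  by rewrite W1 W2; ring.
have [A'h _ _] := A'.
have Z : gradient (fun x => h x + - p 0 * h1 x + - q 0 * h2 x) (fun=> 0) (fun=> 0).
  by apply: gradient_eq A'h _ _ => x; have [] := PQ x.
exists (h 0 + - p 0 * h1 0 + - q 0 * h2 0), (p 0), (q 0) => x.
by rewrite -(gradient0_constant x Z); ring.
Qed.

Lemma affine_function_smooth (R : realType) (a b c d e f : R)
    (h p q : 'rV[R]_2 -> R) :
  affine_function a b c d e f h p q -> smooth h.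
Proof.
move=> [gh gp gq].
pose C (g : 'rV[R]_2 -> R) := [\/ g = h, g = p | g = q].
have L k l : smooth_alg C (fun x => k * p x + l * q x).
  by apply: alg_add; apply: alg_mul; (try exact: alg_const);
    apply: alg_gen; [apply: Or32|apply: Or33].
apply: (@smooth_of_gradients R C); last exact: Or31.
move=> _ [->|->|->].
- by exists p, q; split=> //; apply: alg_gen; [apply: Or32|apply: Or33].
- by do 2![eexists]; split; [exact: gp| |].
- by do 2![eexists]; split; [exact: gq| |].
Qed.

(** * A real exponential solution *)

(** The leading term dominates at M and - M because M is at least 1 and at least
    the sum of the absolute values of the coefficients. *)
Lemma cubic_root (R : realType) (a b c : R) :
  exists x : R, x * x * x + a * (x * x) + b * x + c = 0.
Proof.
pose M := 1 + `|a| + `|b| + `|c|.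
have [a0 b0 c0] := And3 (normr_ge0 a) (normr_ge0 b) (normr_ge0 c).
have [/andP[a1 a2] /andP[b1 b2] /andP[c1 c2]] : [/\ - `|a| <= a <= `|a|,
    - `|b| <= b <= `|b| & - `|c| <= c <= `|c|].
  by split; rewrite -ler_norml.
have M1 : 1 <= M by rewrite /M; lra.
pose p : {poly R} := 'X * 'X * 'X + a *: ('X * 'X) + b *: 'X + c%:P.
have pE x : p.[x] = x * x * x + a * (x * x) + b * x + c by rewrite /p !hornerE.
have MM : M <= M * M by nra.
have aM : `|a * (M * M)| <= `|a| * (M * M).
  by rewrite normrM (ger0_norm (_ : 0 <= M * M))//; nra.
have bM : `|b * M| <= `|b| * (M * M).
  by rewrite normrM ler_wpM2l// ger0_norm//; lra.
have cM : `|c| <= `|c| * (M * M) by nra.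
have ME : M * M * M = M * M + `|a| * (M * M) + `|b| * (M * M) + `|c| * (M * M).
  by rewrite {1}/M; ring.
move: aM bM; rewrite !ler_norml => /andP[aM1 aM2] /andP[bM1 bM2].
have pM : p.[- M] <= 0 <= p.[M].
  by rewrite !pE !mulrNN !mulrN; apply/andP; split; lra.
have NM : - M <= M by lra.
by have [x _ /rootP px] := poly_ivt NM pM; exists x; rewrite -pE.
Qed.

(** The condition for exp (s x1 + t x2) to solve the quasi-Einstein equation. *)
Definition quadric_point (R : realType) (a b c d e f s t : R) :=
  [/\ s * s - (a * s + b * t - (a * d + b * f - b * c - d * d)) = 0,
      s * t - (c * s + d * t - (c * d - b * e)) = 0 &
      t * t - (e * s + f * t - (a * e + c * f - c * c - d * e)) = 0].

(** In the coordinates x = s - d, y = t - c the conics become x y = b e,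
    x (x + 2 d - a) = b (y + 2 c - f), y (y + 2 c - f) = e (x + 2 d - a).
    If b = 0 or e = 0 a common point is visible; otherwise x is nonzero and
    eliminating y = b e / x leaves one cubic equation for x. *)
Lemma quadrics_meet (R : realType) (a b c d e f : R) :
  exists s t : R, quadric_point a b c d e f s t.
Proof.
suff [x [y [H1 H2 H3]]] : exists x y : R,
  [/\ x * x + (2 * d - a) * x = b * (y + (2 * c - f)),
      x * y = b * e &
      y * y + (2 * c - f) * y = e * (x + (2 * d - a))].
  move/eqP: H1; rewrite -subr_eq0 => /eqP N1.
  move/eqP: H2; rewrite -subr_eq0 => /eqP N2.
  move/eqP: H3; rewrite -subr_eq0 => /eqP N3.
  exists (x + d), (y + c); split.
  - by apply: (eq_of_null_terms (k := 1) (l := 0) N1 N2); ring.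
  - by apply: (eq_of_null_terms (k := 1) (l := 0) N2 N3); ring.
  - by apply: (eq_of_null_terms (k := 1) (l := 0) N3 N1); ring.
move: (2 * d - a) (2 * c - f) => s t.
have [->|b0] := eqVneq b 0.
  by exists (- s), 0; split; ring.
have [->|e0] := eqVneq e 0.
  by exists 0, (- t); split; ring.
have [x] := cubic_root s (- (b * t)) (- (b * b * e)).
have [->|x0] := eqVneq x 0.
  rewrite !mulr0 !add0r => /eqP; rewrite oppr_eq0 !mulf_eq0.
  by rewrite (negbTE b0) (negbTE e0).
move=> H; exists x, (b * e / x).
have H' : x * x * x + s * (x * x) = b * (b * e + t * x).
  by apply/eqP; rewrite -subr_eq0 -H; apply/eqP; ring.
split; last first.
- apply: (mulfI (mulf_neq0 x0 x0)).
  have -> : x * x * (b * e / x * (b * e / x) + t * (b * e / x)) =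
      e * (b * (b * e + t * x)).
    by field.
  by rewrite -H'; ring.
- by field.
- apply: (mulfI x0).
  have -> : x * (b * (b * e / x + t)) = b * (b * e + t * x) by field.
  by rewrite -H'; ring.
Qed.

Lemma quadric_point_flat (R : realType) (a b c d e f s t : R) :
  quadric_point a b c d e f s t ->
  [/\ b * e = (c - t) * (d - s),
      (a - 2 * s) * (d - s) + b * (f - 2 * t) = b * (c - t) + (d - s) * (d - s) &
      (c - t) * (c - t) + (d - s) * e = (a - 2 * s) * e + (c - t) * (f - 2 * t)].
Proof.
move=> [N1 N2 N3]; split.
- by apply: (eq_of_null_terms (k := -1) (l := 0) N2 N2); ring.
- by apply: (eq_of_null_terms (k := 1) (l := 0) N1 N2); ring.
- by apply: (eq_of_null_terms (k := -1) (l := 0) N3 N2); ring.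
Qed.

(** * The quasi-Einstein equation in coordinates *)

Definition gamma (R : realType) (D : connection R) (i j k : 'I_2) : R :=
  christoffel D i j k 0.

Lemma frame_smooth (R : realType) i : smooth (@frame R i).
Proof. exact: smooth_const. Qed.

Lemma nabla_frame (R : realType) (D : connection R) i j : type_A D ->
  D (@frame R i) (@frame R j) =
  fun=> gamma D i j 0 *: (@Defs.basis R 0) + gamma D i j 1 *: (@Defs.basis R 1).
Proof.
move=> [_ cD]; apply/funext => p; apply/rowP.
have E k : D (@frame R i) (@frame R j) p 0 k = gamma D i j k by exact: cD.
by apply: forall_ord2; rewrite E !mxE /= ?mulr1 ?mulr0 ?addr0 ?add0r.
Qed.

Lemma gamma_sym (R : realType) (D : connection R) i j k : type_A D ->
  gamma D i j k = gamma D j i k.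
Proof.
move=> [tD _]; have := tD _ _ (frame_smooth i) (frame_smooth j) 0.
rewrite /lie_bracket /frame !derive_cst subrr => /eqP; rewrite subr_eq0 => /eqP.
by rewrite /gamma /christoffel => ->.
Qed.

Lemma nabla_constant (R : realType) (D : connection R) (i : 'I_2)
    (s t : R) : type_A D ->
  D (@frame R i) (fun=> s *: (@Defs.basis R 0) + t *: (@Defs.basis R 1)) =
  fun=> (s * gamma D i 0 0 + t * gamma D i 1 0) *: (@Defs.basis R 0) +
        (s * gamma D i 0 1 + t * gamma D i 1 1) *: (@Defs.basis R 1).
Proof.
move=> AD; apply/funext => p.
have sm (r : R) (l : 'I_2) : smooth (fun _ : 'rV[R]_2 => r *: (@Defs.basis R l)).
  exact: smooth_const.
rewrite (nabla_addr D (frame_smooth i) (sm s 0) (sm t 1)).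
have N (r : R) (l : 'I_2) : D (@frame R i) (fun=> r *: (@Defs.basis R l)) p =
    r *: D (@frame R i) (@frame R l) p.
  rewrite (@nabla_leibniz _ D (fun=> r) (@frame R i) (@frame R l)); last 3 first.
  - exact: smooth_const.
  - exact: frame_smooth.
  - exact: frame_smooth.
  by rewrite derive_cst scale0r add0r.
rewrite !N !nabla_frame //.
by apply/rowP => k; rewrite !mxE; ring.
Qed.

Lemma nabla_zero (R : realType) (D : connection R) (k : 'I_2) p :
  D (fun=> 0) (@frame R k) p = 0.
Proof.
have s0 : smooth (fun _ : 'rV[R]_2 => 0 : R) by exact: smooth_const.
have -> : (fun _ : 'rV[R]_2 => 0 : 'rV[R]_2) = fun q => (0 : R) *: frame 0 q.
  by apply/funext => q; rewrite scale0r.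
by rewrite (nabla_scalel D s0 (frame_smooth 0) (frame_smooth k)) scale0r.
Qed.

Lemma ricci_frame (R : realType) (D : connection R) (j k : 'I_2) p : type_A D ->
  ricci D (@frame R j) (@frame R k) p =
  \sum_i \sum_l (gamma D j k l * gamma D i l i - gamma D i k l * gamma D j l i).
Proof.
move=> AD; rewrite /ricci /mxtrace; apply: eq_bigr => i _.
rewrite mxE /curvature -/(@Defs.basis R i) -/(@frame R i).
have -> : lie_bracket (@frame R i) (@frame R j) = fun=> 0.
  by apply/funext => q; rewrite /lie_bracket /frame !derive_cst subrr.
rewrite nabla_zero !nabla_frame // !nabla_constant // sum_ord2 subr0.
by move: i; apply: forall_ord2; rewrite !mxE /=; ring.
Qed.

Lemma ricci_sym_frame (R : realType) (D : connection R) p : type_A D ->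
  let a := gamma D 0 0 0 in let b := gamma D 0 0 1 in
  let c := gamma D 0 1 0 in let d := gamma D 0 1 1 in
  let e := gamma D 1 1 0 in let f := gamma D 1 1 1 in
  [/\ ricci_sym D (frame 0) (frame 0) p = a * d + b * f - b * c - d * d,
      ricci_sym D (frame 0) (frame 1) p = c * d - b * e,
      ricci_sym D (frame 1) (frame 0) p = c * d - b * e &
      ricci_sym D (frame 1) (frame 1) p = a * e + c * f - c * c - d * e].
Proof.
move=> AD a b c d e f; rewrite /ricci_sym !ricci_frame // !sum_ord2.
by rewrite !(gamma_sym 1 0 _ AD) -/a -/b -/c -/d -/e -/f; split; field.
Qed.

(** The equation as a first order system: (u, v) is the gradient of F, and the
    coefficients of F are the components of the Ricci tensor, up to sign. *)
Definition is_quasi_einstein (R : realType) (a b c d e f : R)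
    (F u v : 'rV[R]_2 -> R) :=
  [/\ gradient F u v,
   gradient u (fun x => a * u x + b * v x - (a * d + b * f - b * c - d * d) * F x)
     (fun x => c * u x + d * v x - (c * d - b * e) * F x) &
   gradient v (fun x => c * u x + d * v x - (c * d - b * e) * F x)
     (fun x => e * u x + f * v x - (a * e + c * f - c * c - d * e) * F x)].

Lemma quasi_einsteinP (R : realType) (D : connection R) (F : 'rV[R]_2 -> R) :
  type_A D ->
  quasi_einstein D F <-> smooth F /\ exists u v,
    is_quasi_einstein (gamma D 0 0 0) (gamma D 0 0 1) (gamma D 0 1 0)
      (gamma D 0 1 1) (gamma D 1 1 0) (gamma D 1 1 1) F u v.
Proof.
move=> AD; have [_ cD] := AD.
have cE i j k p : christoffel D i j k p = gamma D i j k by exact: cD.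
have rE p := ricci_sym_frame p AD.
split=> [[sF QF]|[sF [u [v [gF gu gv]]]]]; split=> //.
  exists (partial 0 F), (partial 1 F); split; first exact: smooth_gradient.
  - have := smooth_gradient
      (smooth_on_derive (@Defs.basis R 0) sF : smooth (partial 0 F)).
    move=> /gradient_eq; apply=> x; have [r00 r01 r10 r11] := rE x.
      have := QF 0 0 x; rewrite /hessian sum_ord2 !cE r00 => H.
      by apply/eqP; rewrite -subr_eq0 -H; apply/eqP; ring.
    have := QF 1 0 x; rewrite /hessian sum_ord2 !cE r10 !(gamma_sym 1 0 _ AD) => H.
    by apply/eqP; rewrite -subr_eq0 -H; apply/eqP; ring.
  - have := smooth_gradient
      (smooth_on_derive (@Defs.basis R 1) sF : smooth (partial 1 F)).
    move=> /gradient_eq; apply=> x; have [r00 r01 r10 r11] := rE x.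
      have := QF 0 1 x; rewrite /hessian sum_ord2 !cE r01 => H.
      by apply/eqP; rewrite -subr_eq0 -H; apply/eqP; ring.
    have := QF 1 1 x; rewrite /hessian sum_ord2 !cE r11 => H.
    by apply/eqP; rewrite -subr_eq0 -H; apply/eqP; ring.
have [F0 F1] := gradient_partial gF.
have [u0 u1] := gradient_partial gu; have [v0 v1] := gradient_partial gv.
move=> i j p; move: i j; have [r00 r01 r10 r11] := rE p.
apply: forall_ord2; apply: forall_ord2;
  rewrite /hessian sum_ord2 !cE ?(gamma_sym 1 0 _ AD) ?r00 ?r01 ?r10 ?r11
    F0 F1 ?u0 ?u1 ?v0 ?v1; ring.
Qed.

(** With phi = (s, t), dividing by exp (s x1 + t x2) subtracts
    phi_i delta_j^k + phi_j delta_i^k from the Christoffel symbols; the terms of order zero that remain are the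
    equations of the conics. *)
Lemma quasi_einstein_affine (R : realType) (a b c d e f s t : R)
    (F u v : 'rV[R]_2 -> R) :
  quadric_point a b c d e f s t ->
  let E (x : 'rV[R]_2) := expR (- s * x 0 0 + - t * x 0 1) in
  is_quasi_einstein a b c d e f F u v ->
  affine_function (a - 2 * s) b (c - t) (d - s) e (f - 2 * t)
    (fun x => E x * F x) (fun x => E x * (u x - s * F x))
    (fun x => E x * (v x - t * F x)).
Proof.
move=> [N1 N2 N3] E [gF gu gv].
have gE : gradient E _ _ := gradient_exp (- s) (- t).
have g1 := gradientD gu (gradientZ (- s) gF).
have g2 := gradientD gv (gradientZ (- t) gF).
have e1 : (fun x => E x * (u x - s * F x)) = (fun x => E x * (u x + - s * F x)).
  by apply/funext => x; ring.
have e2 : (fun x => E x * (v x - t * F x)) = (fun x => E x * (v x + - t * F x)).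
  by apply/funext => x; ring.
split; rewrite ?e1 ?e2.
- by apply: gradient_eq (gradientM gE gF) _ _ => x; rewrite -/(E x); ring.
- apply: gradient_eq (gradientM gE g1) _ _ => x; rewrite -/(E x).
    by apply: (eq_of_null_terms (k := - (E x * F x)) (l := 0) N1 N2); ring.
  by apply: (eq_of_null_terms (k := - (E x * F x)) (l := 0) N2 N2); ring.
- apply: gradient_eq (gradientM gE g2) _ _ => x; rewrite -/(E x).
    by apply: (eq_of_null_terms (k := - (E x * F x)) (l := 0) N2 N2); ring.
  by apply: (eq_of_null_terms (k := - (E x * F x)) (l := 0) N3 N2); ring.
Qed.

Lemma affine_quasi_einstein (R : realType) (a b c d e f s t : R)
    (h p q : 'rV[R]_2 -> R) :
  quadric_point a b c d e f s t ->
  let E (x : 'rV[R]_2) := expR (s * x 0 0 + t * x 0 1) in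
  affine_function (a - 2 * s) b (c - t) (d - s) e (f - 2 * t) h p q ->
  is_quasi_einstein a b c d e f (fun x => E x * h x)
    (fun x => E x * (p x + s * h x)) (fun x => E x * (q x + t * h x)).
Proof.
move=> [N1 N2 N3] E [gh gp gq].
have gE : gradient E _ _ := gradient_exp s t.
have g1 := gradientD gp (gradientZ s gh).
have g2 := gradientD gq (gradientZ t gh).
split.
- by apply: gradient_eq (gradientM gE gh) _ _ => x; rewrite -/(E x); ring.
- apply: gradient_eq (gradientM gE g1) _ _ => x; rewrite -/(E x).
    by apply: (eq_of_null_terms (k := E x * h x) (l := 0) N1 N2); ring.
  by apply: (eq_of_null_terms (k := E x * h x) (l := 0) N2 N2); ring.
- apply: gradient_eq (gradientM gE g2) _ _ => x; rewrite -/(E x).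
    by apply: (eq_of_null_terms (k := E x * h x) (l := 0) N2 N2); ring.
  by apply: (eq_of_null_terms (k := E x * h x) (l := 0) N3 N2); ring.
Qed.

(** * Geodesics *)

Lemma interval_constant (R : realType) (I : set R) (f : R -> R) (s t : R) :
  is_interval I -> (forall x, I x -> is_derive x 1 f 0) -> I s -> I t -> f s = f t.
Proof.
move=> iI df; wlog st : s t / s <= t.
  by move=> H Is It; have [|/ltW] := leP s t => ?; [exact: H|apply/esym/H].
move=> Is It.
have dI (x : R) : x \in `[s, t] -> is_derive x 1 f 0.
  by rewrite in_itv/= => xst; apply: df; exact: (iI s t).
have dIo (x : R) : x \in `]s, t[ -> is_derive x 1 f ((fun=> 0) x).
  by move=> xst; apply: dI; exact: subset_itv_oo_cc.
have fc : {within `[s, t], continuous f}.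
  by apply: derivable_within_continuous => x /dI[].
have [x _ /eqP] := MVT_segment st dIo fc.
by rewrite mul0r subr_eq0 => /eqP.
Qed.

(** In the second derivative of h o sigma the symbols Gamma cancel against the
    geodesic equation.  Only the change of connection survives, which contributes
    -2 (s sigma1' + t sigma2') times the first derivative. *)
Lemma geodesic_velocity (R : realType) (D : connection R) (I : set R)
    (sigma : R -> 'rV[R]_2) (s t : R) (h p q : 'rV[R]_2 -> R) :
  type_A D -> geodesic D I sigma ->
  affine_function (gamma D 0 0 0 - 2 * s) (gamma D 0 0 1) (gamma D 0 1 0 - t)
    (gamma D 0 1 1 - s) (gamma D 1 1 0) (gamma D 1 1 1 - 2 * t) h p q ->
  exists k, forall x : R, I x ->
    is_derive x 1 (h \o sigma)
      (expR (- 2 * (s * sigma x 0 0 + t * sigma x 0 1)) * k).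
Proof.
move=> AD [oI iI ss gs] [gh gp gq]; have [_ cD] := AD.
have cE i j k z : christoffel D i j k z = gamma D i j k by exact: cD.
pose v (x : R) := 'D_1 sigma x; pose w (x : R) := 'D_1 v x.
have v1 : sigma^`()%classic = v by apply/funext => x; rewrite derive1E.
have w1 : sigma^`(2)%classic = w.
  by rewrite derive1nS derive1n1 v1; apply/funext => x; rewrite derive1E.
have dsigma x : I x -> is_diff x sigma (fun r : R => r *: v x).
  by move=> Ix; apply: is_diff_velocity; exact: (ss [::]).
have dv x : I x -> is_diff x v (fun r : R => r *: w x).
  move=> Ix; apply: is_diff_velocity.
  exact: (@smooth_on_derive _ _ _ I sigma 1 ss [::]).
have chain (g a b : 'rV[R]_2 -> R) x : gradient g a b -> I x ->
    is_derive x 1 (fun y => g (sigma y))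
      (v x 0 0 * a (sigma x) + v x 0 1 * b (sigma x)).
  move=> gg Ix.
  have H := is_diff_is_derive (is_diff_comp (dsigma x Ix) (gg (sigma x))).
  by apply: (is_derive_eq H); rewrite /= !mxE !mul1r.
have dvi i x : I x -> is_derive x 1 (fun y => v y 0 i) (w x 0 i).
  move=> Ix; have H := is_diff_is_derive (is_diff_coord 0 i (dv x Ix)).
  by apply: (is_derive_eq H); rewrite !mxE mul1r.
pose y x := v x 0 0 * p (sigma x) + v x 0 1 * q (sigma x).
pose m x := expR (2 * s * sigma x 0 0 + 2 * t * sigma x 0 1).
have my x : I x -> is_derive x 1 (fun z => m z * y z) 0.
  move=> Ix.
  have dm := chain _ _ _ x (gradient_exp (2 * s) (2 * t)) Ix.
  have dy := is_derive1D (is_derive1M (dvi 0 x Ix) (chain _ _ _ x gp Ix))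
    (is_derive1M (dvi 1 x Ix) (chain _ _ _ x gq Ix)).
  apply: is_derive_eq (is_derive1M dm dy) _.
  have g0 := gs x Ix 0; have g1 := gs x Ix 1.
  rewrite w1 v1 !sum_ord2 !cE !(gamma_sym 1 0 _ AD) in g0 g1.
  rewrite -/(m x).
  apply: (eq_of_null_terms (k := m x * p (sigma x)) (l := m x * q (sigma x)) g0 g1).
  by ring.
have [[x0 Ix0]|nI] := pselect (exists x, I x); last first.
  by exists 0; move=> x Ix; case: nI; exists x.
exists (m x0 * y x0); move=> x Ix.
apply: is_derive_eq (chain _ _ _ x gh Ix) _; rewrite -/(y x).
rewrite (interval_constant iI my Ix0 Ix) mulrA -expRD.
have -> : - 2 * (s * sigma x 0 0 + t * sigma x 0 1) +
   (2 * s * sigma x 0 0 + 2 * t * sigma x 0 1) = 0 by ring.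
by rewrite expR0 mul1r.
Qed.

(** Project on U: psi x is the coefficient of the orthogonal projection of X x
    on the line spanned by U, and X - psi U has zero derivative. *)
Lemma velocity_line (R : realType) (I : set R) (X : R -> 'rV[R]_2) (m : R -> R)
    (U : 'rV[R]_2) :
  is_interval I ->
  (forall x i, I x -> is_derive x 1 (fun y => X y 0 i) (m x * U 0 i)) ->
  exists k0 k1 (v : 'rV[R]_2), forall x, I x ->
    X x = (k0 * X x 0 0 + k1 * X x 0 1) *: U + v.
Proof.
move=> iI dX.
have [[x0 Ix0]|nI] := pselect (exists x, I x); last first.
  by exists 0, 0, 0; move=> x Ix; case: nI; exists x.
pose n := U 0 0 * U 0 0 + U 0 1 * U 0 1.
pose psi x := U 0 0 / n * X x 0 0 + U 0 1 / n * X x 0 1.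
have Un i : (U 0 0 / n * U 0 0 + U 0 1 / n * U 0 1) * U 0 i = U 0 i.
  have [n0|n0] := eqVneq n 0; last first.
    have -> : U 0 0 / n * U 0 0 + U 0 1 / n * U 0 1 = 1.
      by rewrite mulrAC [X in _ + X]mulrAC -mulrDl divff.
    by rewrite mul1r.
  (* For U = 0 the inverse of n is 0 and the projection is 0, as it should. *)
  have /andP[/eqP U0 /eqP U1] : (U 0 0 * U 0 0 == 0) && (U 0 1 * U 0 1 == 0).
    by rewrite -paddr_eq0 -?expr2 ?sqr_ge0// !expr2 -/n n0.
  suff -> : U 0 i = 0 by rewrite mulr0.
  move: U0 => /eqP; rewrite mulf_eq0 orbb => /eqP U0.
  move: U1 => /eqP; rewrite mulf_eq0 orbb => /eqP U1.
  by move: i; apply: forall_ord2.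
exists (U 0 0 / n), (U 0 1 / n), (X x0 - psi x0 *: U) => x Ix.
rewrite -/(psi x).
apply/rowP => i; rewrite !mxE.
have dZ (y : R) : I y -> is_derive y 1 (fun z => X z 0 i + - U 0 i * psi z) 0.
  move=> Iy; apply: is_derive_eq (is_derive1D (dX y i Iy) (is_derive1Ml (- U 0 i)
    (is_derive1D (is_derive1Ml (U 0 0 / n) (dX y 0 Iy))
                 (is_derive1Ml (U 0 1 / n) (dX y 1 Iy))))) _.
  rewrite -[in m y * U 0 i]Un; ring.
have := interval_constant iI dZ Ix Ix0 => H.
have -> : X x 0 i = (X x 0 i + - U 0 i * psi x) + psi x * U 0 i by ring.
by rewrite H; ring.
Qed.

(** * The theorem *)

Lemma pair_map_smooth (R : realType) (f1 f2 : 'rV[R]_2 -> R) :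
  smooth f1 -> smooth f2 -> smooth (pair_map f1 f2).
Proof.
move=> s1 s2; apply: smooth_on_mx => [|i j]; first exact: openT.
have -> : (fun x => pair_map f1 f2 x i j) = if j == 0 then f1 else f2.
  by apply/funext => x; rewrite mxE; case: ifP.
by case: ifP.
Qed.

Lemma diff_pair_map (R : realType) (h1 p1 q1 h2 p2 q2 : 'rV[R]_2 -> R) x v :
  gradient h1 p1 q1 -> gradient h2 p2 q2 -> differentiable (pair_map h1 h2) x ->
  'd (pair_map h1 h2) x v =
    pair_map (fun=> v 0 0 * p1 x + v 0 1 * q1 x)
             (fun=> v 0 0 * p2 x + v 0 1 * q2 x) x.
Proof.
move=> g1 g2 /differentiableP dP; apply/rowP; apply: forall_ord2; rewrite mxE /=.
  rewrite -(is_diff_derive v (g1 x)) -(is_diff_derive v (is_diff_coord 0 0 dP)).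
  by congr ('D_v _ x); apply/funext => y; rewrite mxE.
rewrite -(is_diff_derive v (g2 x)) -(is_diff_derive v (is_diff_coord 0 1 dP)).
by congr ('D_v _ x); apply/funext => y; rewrite mxE.
Qed.

(** The determinant of the Jacobian is the Wronskian of h1 and h2. *)
Lemma jacobian_pair_map_unit (R : realType) (a b c d e f : R)
    (h1 p1 q1 h2 p2 q2 : 'rV[R]_2 -> R) x :
  affine_function a b c d e f h1 p1 q1 -> p1 0 = 1 -> q1 0 = 0 ->
  affine_function a b c d e f h2 p2 q2 -> p2 0 = 0 -> q2 0 = 1 ->
  jacobian (pair_map h1 h2) x \in unitmx.
Proof.
move=> A1 p10 q10 A2 p20 q20.
have [g1 _ _] := A1; have [g2 _ _] := A2.
have sP := pair_map_smooth (affine_function_smooth A1) (affine_function_smooth A2).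
rewrite -row_free_unit; apply/inj_row_free => v.
rewrite mul_rV_lin1 (diff_pair_map v g1 g2 (sP [::] x Logic.I)) => /rowP vJ.
have := vJ 0; have := vJ 1; rewrite !mxE /= => E2 E1.
have := wronskian_exp x A1 A2.
rewrite p10 q10 p20 q20 mulr1 mul0r subr0 mul1r => W.
have W0 : p1 x * q2 x - q1 x * p2 x != 0 by rewrite W gt_eqF// expR_gt0.
apply/rowP; apply: forall_ord2; rewrite mxE; apply: (mulIf W0); rewrite mul0r.
  by apply: (eq_of_null_terms (k := q2 x) (l := - q1 x) E1 E2); ring.
by apply: (eq_of_null_terms (k := - p2 x) (l := p1 x) E1 E2); ring.
Qed.

Lemma geodesic_image_line (R : realType) (D : connection R) (I : set R)
    (sigma : R -> 'rV[R]_2) (s t : R) (h1 p1 q1 h2 p2 q2 : 'rV[R]_2 -> R) :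
  type_A D -> geodesic D I sigma ->
  affine_function (gamma D 0 0 0 - 2 * s) (gamma D 0 0 1) (gamma D 0 1 0 - t)
    (gamma D 0 1 1 - s) (gamma D 1 1 0) (gamma D 1 1 1 - 2 * t) h1 p1 q1 ->
  affine_function (gamma D 0 0 0 - 2 * s) (gamma D 0 0 1) (gamma D 0 1 0 - t)
    (gamma D 0 1 1 - s) (gamma D 1 1 0) (gamma D 1 1 1 - 2 * t) h2 p2 q2 ->
  exists (psi : R -> R) (u v : 'rV[R]_2), smooth_on I psi /\
    forall x, I x -> pair_map h1 h2 (sigma x) = psi x *: u + v.
Proof.
move=> AD gs A1 A2; have [oI iI ss _] := gs.
have sh1 := affine_function_smooth A1; have sh2 := affine_function_smooth A2.
have Phi0 x : pair_map h1 h2 x 0 0 = h1 x by rewrite mxE.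
have Phi1 x : pair_map h1 h2 x 0 1 = h2 x by rewrite mxE.
have [k1 dk1] := geodesic_velocity AD gs A1.
have [k2 dk2] := geodesic_velocity AD gs A2.
pose u := pair_map (fun=> k1) (fun=> k2) 0.
pose m x := expR (- 2 * (s * sigma x 0 0 + t * sigma x 0 1)).
have dX x i : I x ->
    is_derive x 1 (fun y => pair_map h1 h2 (sigma y) 0 i) (m x * u 0 i).
  move=> Ix; move: i; apply: forall_ord2; rewrite mxE /=.
    have -> : (fun y => pair_map h1 h2 (sigma y) 0 0) = h1 \o sigma.
      by apply/funext => y; exact: Phi0.
    exact: dk1.
  have -> : (fun y => pair_map h1 h2 (sigma y) 0 1) = h2 \o sigma.
    by apply/funext => y; exact: Phi1.
  exact: dk2.
have [l1 [l2 [v Xuv]]] := velocity_line iI dX.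
exists (fun x => l1 * h1 (sigma x) + l2 * h2 (sigma x)), u, v; split.
  apply: smooth_on_alg => //; apply: alg_add; apply: alg_mul;
    try exact: alg_const.
  - by apply: alg_gen; exact: (smooth_on_comp_curve oI ss sh1).
  - by apply: alg_gen; exact: (smooth_on_comp_curve oI ss sh2).
by move=> x Ix; rewrite {1}Xuv// Phi0 Phi1.
Qed.

Theorem theorem1p6 (R : realType) (D : connection R) (hD : type_A D) :
  exists phi phi1 phi2 : 'rV[R]_2 -> R,
    linear_function phi /\ smooth phi1 /\ smooth phi2 /\
    quasi_einstein D =
      [set (fun p => expR (phi p) * f p)
        | f in span3 (fun _ => 1) phi1 phi2] /\
    immersion (pair_map phi1 phi2) /\
    forall (I : set R) (sigma : R -> 'rV[R]_2), geodesic D I sigma ->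
      exists (psi : R -> R) (u v : 'rV[R]_2),
        smooth_on I psi /\
        forall t0, I t0 ->
          exists (U V : set 'rV[R]_2) (G : 'rV[R]_2 -> 'rV[R]_2),
            local_inverse (pair_map phi1 phi2) U V G /\ U (sigma t0) /\
            \forall t \near t0,
              V (psi t *: u + v) /\ sigma t = G (psi t *: u + v).
Proof.
set a := gamma D 0 0 0; set b := gamma D 0 0 1; set c := gamma D 0 1 0.
set d := gamma D 0 1 1; set e := gamma D 1 1 0; set f := gamma D 1 1 1.
have [s [t st]] := quadrics_meet a b c d e f.
have [F1 F2 F3] := quadric_point_flat st.
have [h1 [p1 [q1 [A1 p10 q10]]]] := affine_function_exists 1 0 F1 F2 F3.
have [h2 [p2 [q2 [A2 p20 q20]]]] := affine_function_exists 0 1 F1 F2 F3.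
have sh1 := affine_function_smooth A1; have sh2 := affine_function_smooth A2.
have sPhi := pair_map_smooth sh1 sh2.
have uJ x := jacobian_pair_map_unit x A1 p10 q10 A2 p20 q20.
exists (fun x => s * x 0 0 + t * x 0 1), h1, h2.
split; first by exists s, t.
do 2![split=> //].
split; last split.
- apply/seteqP; split.
    move=> F /(quasi_einsteinP F hD)[sF [u [v QF]]].
    have A := quasi_einstein_affine st QF.
    have [k [k1 [k2 hk]]] := affine_function_span A A1 p10 q10 A2 p20 q20.
    exists (fun x => k * 1 + k1 * h1 x + k2 * h2 x); first by exists k, k1, k2.
    apply/funext => x; rewrite mulr1 -hk mulrA -expRD !mulNr -opprD subrr.
    by rewrite expR0 mul1r.
  move=> _ [h [c0 [c1 [c2 ->]]] <-].
  have A := affine_function_comb c2 (affine_function_comb c1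
    (affine_function_constant (a - 2 * s) b (c - t) (d - s) e (f - 2 * t) c0) A1) A2.
  rewrite [X in quasi_einstein D X](_ : _ = fun x : 'rV[R]_2 =>
      expR (s * x 0 0 + t * x 0 1) * (c0 + c1 * h1 x + c2 * h2 x)); last first.
    by apply/funext => x; rewrite mulr1.
  apply/(quasi_einsteinP _ hD); split.
    apply: smooth_onM; [exact: openT|exact: exp_smooth|].
    exact: affine_function_smooth A.
  by do 2![eexists]; exact: (affine_quasi_einstein st A).
- split=> // x v w; rewrite -!(mul_rV_lin1 ('d (pair_map h1 h2) x)).
  exact: (can_inj (mulmxK (uJ x))).
move=> I sigma gs; have [oI _ ss _] := gs.
have [psi [u [v [spsi Xpsi]]]] := geodesic_image_line hD gs A1 A2.
exists psi, u, v; split=> // t0 It0.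
have [U [V [G [[oU oV sG] FV GU Ut0]]]] := inverse_function (sigma t0) sPhi uJ.
exists U, V, G; split; first by split.
split=> //.
have cs : {for t0, continuous sigma}.
  by apply: differentiable_continuous; exact: (ss [::]).
have nI : \forall x \near t0, I x by exact: open_nbhs_nbhs.
have nU : \forall x \near t0, U (sigma x) by apply: cs; exact: open_nbhs_nbhs.
near=> x.
have Ix : I x by near: x.
have [VF GF] : V (pair_map h1 h2 (sigma x)) /\
    G (pair_map h1 h2 (sigma x)) = sigma x by apply: FV; near: x.
by rewrite -Xpsi// GF.
Unshelve. all: by end_near. Qed.
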